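(* Let $(M,h)$ be a closed Riemannian spin manifold, let $(N,g)$ be a Riemannian manifold of constant curvature $K$, let $X$ be a Killing vector field on $N$, let $\kappa\in\mathbb{R}$, and let $(\phi,\psi)$ be a smooth $\kappa$-Dirac-harmonic map from $M$ to $N$. Then the current defined by $$J_\alpha:=2\langle d\phi(e_\alpha),X(\phi)\rangle-\langle\nabla_\psi X(\phi),e_\alpha\cdot\psi\rangle$$ is conserved, that is, $\nabla_{e_\alpha}J_\alpha=0$ (the divergence of $J$ on $M$ vanishes).
   Context: $\Sigma M$ is the spinor bundle of $(M,h)$ with hermitian scalar product $\langle\cdot,\cdot\rangle_{\Sigma M}$ (conjugate-linear in the first slot, linear in the second) and metric spin connection. Clifford multiplication is skew-symmetric, $\langle\psi,Y\cdot\eta\rangle=-\langle Y\cdot\psi,\eta\rangle$, and satisfies $Y\cdot Z\cdot\psi+Z\cdot Y\cdot\psi=-2h(Y,Z)\psi$. $(e_\alpha)$ is a local orthonormal frame of $TM$ and repeated indices are summed. For a map $\phi\colon M\to N$, a vector spinor is a section $\psi$ of $\Sigma M\otimes\phi^\ast TN$, locally $\psi=\psi^i\otimes\partial_{y^i}$ with $\partial_{y^i}$ a local basis of $TN$ along $\phi$. With $\tilde\nabla$ the induced connection on $\Sigma M\otimes\phi^\ast TN$, the twisted Dirac operator is $\not D=e_\alpha\cdot\tilde\nabla_{e_\alpha}$. Put $R^N(Y,Z)=[\nabla_Y,\nabla_Z]-\nabla_{[Y,Z]}$ and $R_{ijkl}=\langle R^N(\partial_{y^i},\partial_{y^j})\partial_{y^l},\partial_{y^k}\rangle$,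 so that constant curvature $K$ means $R_{ijkl}=K(g_{ik}g_{jl}-g_{il}g_{jk})$. $\kappa$-Dirac-harmonic maps are the critical points of $$E_\kappa(\phi,\psi)=\int_M\big(|d\phi|^2+\langle\psi,\not D\psi\rangle+\kappa R_{ijkl}\langle\psi^i,\psi^k\rangle_{\Sigma M}\langle\psi^j,\psi^l\rangle_{\Sigma M}\big)dM,$$ i.e. the solutions of $$\tau(\phi)=\tfrac12\langle\psi^i,e_\alpha\cdot\psi^j\rangle R^N(\partial_{y^i},\partial_{y^j})d\phi(e_\alpha)+\tfrac{\kappa}{2}(\nabla^\sharp R)_{ijkl}\langle\psi^i,\psi^k\rangle\langle\psi^j,\psi^l\rangle,$$ $$(\not D\psi)^i=-2\kappa\, R^{i}{}_{jkl}\langle\psi^j,\psi^l\rangle\psi^k,$$ where $\tau(\phi)$ is the tension field and $(\nabla^\sharp R)_{ijkl}$ is the vector dual to $V\mapsto(\nabla_VR)_{ijkl}$. A vector field $X$ on $N$ is Killing if $\mathcal{L}_Xg=0$, i.e. $\nabla_{\partial_{y^i}}X_j+\nabla_{\partial_{y^j}}X_i=0$. The notation in $J_\alpha$ means $$\langle\nabla_\psi X(\phi),e_\alpha\cdot\psi\rangle:=\langle\psi^i,e_\alpha\cdot\psi^j\rangle_{\Sigma M}\,\nabla_{\partial_{y^i}}X_j,$$ with $X_j=g_{jk}X^k$, evaluated along $\phi$. $J$ is viewed as a one-form (vector field) on $M$ with $J_\alpha=J(e_\alpha)$. *)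

(* Defs.v *)
From HB Require Import structures.
From mathcomp Require Import all_boot all_order all_algebra.
From mathcomp Require Import all_classical all_reals all_analysis.
From mathcomp Require Export complex.
Set Implicit Arguments.
Unset Strict Implicit.
Unset Printing Implicit Defensive.
Import Order.TTheory GRing.Theory Num.Theory.
Import numFieldNormedType.Exports.
Local Open Scope classical_set_scope.
Local Open Scope ring_scope.
Local Open Scope complex_scope.

(* Fields on a manifold are functions of the point p.  A tensor field is given
   by its components in every chart, subject to the usual transformation law;
   what such a family does outside the domain of the chart is irrelevant. *)

Record charted (R : realType) (m : nat) := Charted {
  carrier :> topologicalType;
  chart : Type;
  dom : chart -> set carrier;
  coord : chart -> carrier -> 'rV[R]_m;
  point : chart -> 'rV[R]_m -> carrier
}.
Arguments dom {R m M} a : rename.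
Arguments coord {R m M} a p : rename.
Arguments point {R m M} a x : rename.

Section Smooth.
Context {R : realType} {m : nat} {M : charted R m}.
Implicit Types (a b : chart M) (U : set M) (f : M -> R) (p : M).

Definition pd a (i : 'I_m) f p : R :=
  'D_(delta_mx 0 i) (f \o point a) (coord a p).

(* Class C^k on U in the chart a, for U an open subset of dom a. *)
Fixpoint Ck a U (k : nat) f : Prop :=
  (forall p, U p -> {for p, continuous f}) /\
  (if k is k'.+1 then
     forall i, (forall p, U p ->
                  derivable (f \o point a) (coord a p) (delta_mx 0 i)) /\
               Ck a U k' (pd a i f)
   else True).

Definition smooth_on U f := forall a k, Ck a (U `&` dom a) k f.

Definition jac a b p : 'M[R]_m :=
  \matrix_(i, j) pd a i (fun q => coord b q 0 j) p.

Definition smoothC_on U (f : M -> R[i]) :=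
  smooth_on U (fun p => complex.Re (f p)) /\
  smooth_on U (fun p => complex.Im (f p)).

Definition pdC a (i : 'I_m) (f : M -> R[i]) p : R[i] :=
  pd a i (fun q => complex.Re (f q)) p +i* pd a i (fun q => complex.Im (f q)) p.

End Smooth.

Record manifold (R : realType) (m : nat) := Manifold {
  charted_of :> charted R m;
  mfd_hausdorff : hausdorff_space charted_of;
  mfd_second_countable : @second_countable charted_of;
  dom_cover : forall p : charted_of, exists a, dom a p;
  dom_open : forall a : chart charted_of, open (dom a);
  image_open : forall a : chart charted_of, open (coord a @` dom a);
  coordK : forall (a : chart charted_of) p, dom a p -> point a (coord a p) = p;
  coord_continuous : forall (a : chart charted_of) p, dom a p ->
    {for p, continuous (coord a)};
  point_continuous : forall (a : chart charted_of) p, dom a p ->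
    {for coord a p, continuous (point a)};
  transition_smooth : forall (b : chart charted_of) j,
    smooth_on (dom b) (fun p => coord b p 0 j)
}.

(* Closed: compact without boundary; charts are onto open subsets of R^m, so
   there is never a boundary. *)
Definition closed_manifold (R : realType) (m : nat) (M : manifold R m) :=
  compact [set: M].

Definition vector_field_on (R : realType) (m : nat) (M : manifold R m)
    (U : set M) (X : chart M -> M -> 'rV[R]_m) :=
  (forall a i, smooth_on (U `&` dom a) (fun p => X a p 0 i)) /\
  (forall a b p, U p -> dom a p -> dom b p -> X b p = X a p *m jac a b p).

Record metric (R : realType) (m : nat) (M : manifold R m) := Metric {
  gmx :> chart M -> M -> 'M[R]_m;
  metric_smooth : forall a i j, smooth_on (dom a) (fun p => gmx a p i j);
  metric_sym : forall a p, dom a p -> (gmx a p)^T = gmx a p;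
  metric_posdef : forall a p, dom a p -> forall v : 'rV[R]_m, v != 0 ->
    0 < (v *m gmx a p *m v^T) 0 0;
  metric_transform : forall a b p, dom a p -> dom b p ->
    gmx a p = jac a b p *m gmx b p *m (jac a b p)^T
}.

Section LeviCivita.
Context {R : realType} {m : nat} {M : manifold R m} (g : metric M).
Implicit Types (a : chart M) (p : M) (i j k l q r s : 'I_m).
Implicit Types (X : chart M -> M -> 'rV[R]_m).

Definition inner a p (u v : 'rV[R]_m) : R :=
  \sum_i \sum_j g a p i j * u 0 i * v 0 j.

(* Gamma^k_{ij} *)
Definition christoffel a k i j p : R :=
  2^-1 * \sum_l invmx (g a p) k l *
    (pd a i (fun x => g a x j l) p + pd a j (fun x => g a x i l) p
     - pd a l (fun x => g a x i j) p).

(* j-th component of nabla_i X *)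
Definition nabla_vec X a i j p : R :=
  pd a i (fun x => X a x 0 j) p + \sum_k christoffel a j i k p * X a p 0 k.

(* X_j = g_{jk} X^k *)
Definition lower X a j p : R := \sum_k g a p j k * X a p 0 k.

(* nabla_i X_j *)
Definition nabla_lower X a i j p : R :=
  pd a i (lower X a j) p - \sum_k christoffel a k i j p * lower X a k p.

Definition killing X :=
  forall a p, dom a p -> forall i j,
    nabla_lower X a i j p + nabla_lower X a j i p = 0.

(* k-th component of R(d_i, d_j) d_l, where
   R(Y, Z) = [nabla_Y, nabla_Z] - nabla_[Y, Z] *)
Definition riemann a i j l k p : R :=
  pd a i (christoffel a k j l) p - pd a j (christoffel a k i l) p
  + \sum_q (christoffel a k i q p * christoffel a q j l p
            - christoffel a k j q p * christoffel a q i l p).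

(* R_{ijkl} = <R(d_i, d_j) d_l, d_k> *)
Definition curv a i j k l p : R := \sum_q g a p q k * riemann a i j l q p.

(* R^i_{jkl} *)
Definition curv_up a i j k l p : R :=
  \sum_q invmx (g a p) i q * curv a q j k l p.

(* (nabla_r R)_{ijkl} *)
Definition nabla_curv a r i j k l p : R :=
  pd a r (curv a i j k l) p
  - \sum_q (christoffel a q r i p * curv a q j k l p
            + christoffel a q r j p * curv a i q k l p
            + christoffel a q r k p * curv a i j q l p
            + christoffel a q r l p * curv a i j k q p).

(* s-th component of the vector dual to V |-> (nabla_V R)_{ijkl} *)
Definition nabla_curv_sharp a s i j k l p : R :=
  \sum_r invmx (g a p) s r * nabla_curv a r i j k l p.

Definition constant_curvature (K : R) :=
  forall a p, dom a p -> forall i j k l,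
    curv a i j k l p
    = K * (g a p i k * g a p j l - g a p i l * g a p j k).

End LeviCivita.

Definition spdim (m : nat) : nat := (2 ^ m./2)%N.

(* A complex Clifford module of dimension 2^[m/2] is automatically irreducible:
   gam is the action of an orthonormal basis of R^m on complex spinors. *)
Record clifford_rep (R : realType) (m : nat) := CliffordRep {
  gam :> 'I_m -> 'M[R[i]]_(spdim m);
  clifford : forall i j,
    gam i *m gam j + gam j *m gam i = (- 2 * (i == j)%:R)%:M;
  gam_skew : forall i, (map_mx (@conjc R) (gam i))^T = - gam i
}.

Definition clifford_mul (R : realType) (m : nat) (gam : clifford_rep R m)
    (v : 'rV[R]_m) : 'M[R[i]]_(spdim m) :=
  \sum_i (v 0 i)%:C *: gam i.

(* Spin(m): products of an even number of unit vectors.  The even complex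
   Clifford algebra acts faithfully on spinors, so that Spin(m) is identified
   with its image in the matrices. *)
Definition spin_group (R : realType) (m : nat) (gam : clifford_rep R m)
    (S : 'M[R[i]]_(spdim m)) : Prop :=
  exists vs : seq 'rV[R]_m,
    [/\ ~~ odd (size vs),
        (forall v, v \in vs -> \sum_i v 0 i ^+ 2 = 1)
      & S = \big[mulmx/1%:M]_(v <- vs) clifford_mul gam v].

(* A spin structure as a cocycle: a cover of M by open sets with orthonormal
   frames, and a lift to Spin(m) of the transition functions between these
   frames.  Where the frames s and t both live,
     e^t_j = sum_i h(e^s_i, e^t_j) e^s_i,
   and lift s t changes spinor components from t to s; lift_covers says that
   lift s t is mapped to the change of frame under Spin(m) -> SO(m). *)
Record spin_structure (R : realType) (m : nat) (M : manifold R m)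
    (h : metric M) (gam : clifford_rep R m) := SpinStructure {
  sp_idx : Type;
  sp_dom : sp_idx -> set M;
  frame : sp_idx -> 'I_m -> chart M -> M -> 'rV[R]_m;
  lift : sp_idx -> sp_idx -> M -> 'M[R[i]]_(spdim m);
  sp_open : forall t, open (sp_dom t);
  sp_cover : forall p : M, exists t, sp_dom t p;
  frame_field : forall t i, vector_field_on (sp_dom t) (frame t i);
  frame_orthonormal : forall t a p, sp_dom t p -> dom a p -> forall i j,
    inner h a p (frame t i a p) (frame t j a p) = (i == j)%:R;
  lift_smooth : forall s t i j,
    smoothC_on (sp_dom s `&` sp_dom t) (fun p => lift s t p i j);
  lift_spin : forall s t p, sp_dom s p -> sp_dom t p ->
    spin_group gam (lift s t p);
  lift_covers : forall s t a p, sp_dom s p -> sp_dom t p -> dom a p ->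
    forall j, lift s t p *m gam j
      = (\sum_i (inner h a p (frame s i a p) (frame t j a p))%:C *: gam i)
        *m lift s t p;
  lift_cocycle : forall r s t p, sp_dom r p -> sp_dom s p -> sp_dom t p ->
    lift r s p *m lift s t p = lift r t p
}.

(* Hermitian product, conjugate-linear in the first slot. *)
Definition herm (R : realType) (d : nat) (u v : 'cV[R[i]]_d) : R[i] :=
  \sum_i conjc (u i 0) * v i 0.

Definition smooth_map (R : realType) (m n : nat) (M : manifold R m)
    (N : manifold R n) (phi : M -> N) :=
  continuous phi /\
  forall (b : chart N) j,
    smooth_on (phi @^-1` dom b) (fun p => coord b (phi p) 0 j).

Section DiracHarmonic.
Context {R : realType} {m n : nat} {M : manifold R m} {h : metric M}.
Context {gam : clifford_rep R m} (sp : spin_structure h gam).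
Context {N : manifold R n} (g : metric N) (phi : M -> N).
(* psi t b p i is psi^i at p: its spinor components in the trivialization t,
   for the basis d/dy^i of the chart b of N. *)
Variable psi : sp_idx sp -> chart N -> M -> 'I_n -> 'cV[R[i]]_(spdim m).
Implicit Types (t : sp_idx sp) (a : chart M) (b : chart N) (p : M).
Implicit Types (al be ga mu nu la : 'I_m) (i j k l : 'I_n).

Definition vector_spinor :=
  (forall t b i s, smoothC_on (sp_dom t `&` phi @^-1` dom b)
                     (fun p => psi t b p i s 0)) /\
  (forall s t b c p, sp_dom s p -> sp_dom t p ->
     dom b (phi p) -> dom c (phi p) -> forall j,
     psi s c p j
     = \sum_i (jac b c (phi p) i j)%:C *: (lift s t p *m psi t b p i)).

(* h(nabla_mu e_be, e_ga) *)
Definition spin_form t a mu be ga p : R :=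
  inner h a p (\row_nu nabla_vec h (frame t be) a mu nu p) (frame t ga a p).

(* i-th component of d phi(d_mu) *)
Definition dphi a b mu i p : R := pd a mu (fun q => coord b (phi q) 0 i) p.

(* i-th component of d phi(e_al) *)
Definition dphi_frame t a b al i p : R :=
  \sum_mu frame t al a p 0 mu * dphi a b mu i p.

(* i-th component of (nabla d phi)(d_mu, d_nu) *)
Definition hess a b mu nu i p : R :=
  pd a mu (dphi a b nu i) p
  - \sum_la christoffel h a la mu nu p * dphi a b la i p
  + \sum_j \sum_k christoffel g b i j k (phi p) * dphi a b mu j p
                  * dphi a b nu k p.

(* tau(phi) = (nabla d phi)(e_al, e_al) *)
Definition tension t a b i p : R :=
  \sum_al \sum_mu \sum_nu
    frame t al a p 0 mu * frame t al a p 0 nu * hess a b mu nu i p.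

(* Connection on Sigma M (x) phi^* TN, along d_mu; the spin connection is
   d + 1/4 sum_{be,ga} h(nabla e_be, e_ga) e_be . e_ga . *)
Definition nabla_psi t a b mu i p : 'cV[R[i]]_(spdim m) :=
  \col_s pdC a mu (fun q => psi t b q i s 0) p
  + 4^-1 *: \sum_be \sum_ga
      (spin_form t a mu be ga p)%:C *: (gam be *m gam ga *m psi t b p i)
  + \sum_j \sum_k (christoffel g b i j k (phi p) * dphi a b mu j p)%:C
                  *: psi t b p k.

Definition dirac t a b i p : 'cV[R[i]]_(spdim m) :=
  \sum_al gam al *m
    (\sum_mu (frame t al a p 0 mu)%:C *: nabla_psi t a b mu i p).

Definition kappa_dirac_harmonic (kappa : R) :=
  forall t a b p, sp_dom t p -> dom a p -> dom b (phi p) -> forall r : 'I_n,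
  (tension t a b r p)%:C
  = 2^-1 * (\sum_al \sum_i \sum_j \sum_l
       herm (psi t b p i) (gam al *m psi t b p j)
       * (riemann g b i j l r (phi p) * dphi_frame t a b al l p)%:C)
    + (kappa / 2)%:C * (\sum_i \sum_j \sum_k \sum_l
       (nabla_curv_sharp g b r i j k l (phi p))%:C
       * herm (psi t b p i) (psi t b p k) * herm (psi t b p j) (psi t b p l))
  /\
  dirac t a b r p
  = (- 2 * kappa)%:C *: \sum_j \sum_k \sum_l
      ((curv_up g b r j k l (phi p))%:C
       * herm (psi t b p j) (psi t b p l)) *: psi t b p k.

(* J_al = J(e_al), as a function of the point.  It is a priori complex. *)
Definition current (X : chart N -> N -> 'rV[R]_n) t a b al p : R[i] :=
  (2 * inner g b (phi p) (\row_i dphi_frame t a b al i p) (X b (phi p)))%:C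
  - \sum_i \sum_j herm (psi t b p i) (gam al *m psi t b p j)
                  * (nabla_lower g X b i j (phi p))%:C.

(* Divergence of the one-form J with J(e_al) = J al:
   (nabla_{e_al} J)(e_al) = e_al (J(e_al)) - J(nabla_{e_al} e_al). *)
Definition divergence t a (J : 'I_m -> M -> R[i]) p : R[i] :=
  \sum_al \sum_mu (frame t al a p 0 mu)%:C *
    (pdC a mu (J al) p - \sum_be (spin_form t a mu al be p)%:C * J be p).

Definition conserved (J : sp_idx sp -> chart M -> chart N -> 'I_m -> M -> R[i])
  := forall t a b p, sp_dom t p -> dom a p -> dom b (phi p) ->
       divergence t a (J t a b) p = 0.

End DiracHarmonic.

(* Main.v *)
(** Write [e_al] for the frame and [S_ij = nabla_i X_j].  The Leibniz rule for
    the pullback connections gives, for any Killing field,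
    [div J = 2 <tau, X> + 2 S(dphi e_al, dphi e_al)
             - (<psi^i, D psi^j> - <D psi^i, psi^j>) S_ij
             - <psi^i, e_al psi^j> (nabla_{dphi e_al} S)_ij].
    The second term vanishes because [S] is antisymmetric.  Commuting
    derivatives and using the Bianchi identity turns the Killing equation into
    [nabla_k nabla_i X_j = <R(d_i, d_j) d_k, X>], so that the curvature term of
    [2 <tau, X>] cancels the fourth term.  Constant curvature enters twice: it
    gives [nabla R = 0], which leaves no other term in [tau], and it makes the
    right-hand side of the Dirac equation act symmetrically on the components
    [psi^i], which kills the third term. *)

From HB Require Import structures.
From mathcomp Require Import all_boot all_order all_algebra.
From mathcomp Require Import all_classical all_reals all_analysis.
From mathcomp Require Import ring lra.
Require Import Defs.

Set Implicit Arguments.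
Unset Strict Implicit.
Unset Printing Implicit Defensive.
Import Order.TTheory GRing.Theory Num.Theory.
Import numFieldNormedType.Exports.
Local Open Scope classical_set_scope.
Local Open Scope ring_scope.
Local Open Scope complex_scope.

Section DirectionalDerivatives.
Context {R : numFieldType}.
Implicit Types U V W : normedModType R.

Lemma is_derive_translate V W (f : V -> W) x v a df :
  is_derive (x + a) v f df -> is_derive x v (fun y => f (y + a)) df.
Proof.
case=> dfxa <-.
have quotientE : (fun h => h^-1 *:
      (((fun y => f (y + a)) \o shift x) (h *: v) - f (x + a))) =
    (fun h => h^-1 *: ((f \o shift (x + a)) (h *: v) - f (x + a))).
  by apply/funext => h /=; rewrite addrA.
by split; rewrite /derivable /derive quotientE.
Qed.

Lemma is_derive_line V W (f : V -> W) x v (s : R) df :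
  is_derive s (1 : R) (fun t => f (x + t *: v)) df <->
  is_derive (x + s *: v) v f df.
Proof.
have quotientE : (fun h => h^-1 *: (((fun t : R => f (x + t *: v)) \o shift s)
    (h *: (1 : R)) - f (x + s *: v))) =
    (fun h => h^-1 *: ((f \o shift (x + s *: v)) (h *: v) - f (x + s *: v))).
  apply/funext => h /=; rewrite [h *: 1]mulr1 scalerDl.
  by congr (_ *: (f _ - _)); rewrite addrCA.
by split=> -[df' <-]; split; move: df'; rewrite /derivable /derive quotientE.
Qed.

Lemma is_derive_diff_comp U V W (f : V -> W) (c : U -> V) x v dc :
  differentiable f (c x) -> is_derive x v c dc ->
  is_derive x v (f \o c) ('d f (c x) dc).
Proof.
move=> df dcx; pose l (t : R) := c (x + t *: v).
have x0 : x + 0 *: v = x by rewrite scale0r addr0.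
have dl : is_derive (0 : R) (1 : R) l dc by apply/is_derive_line; rewrite x0.
have [l1 dlE] := dl; have dfl : differentiable f (l 0) by rewrite /l x0.
have dl0 : differentiable l 0 by apply/derivable1_diffP.
have dfl0 := differentiable_comp dl0 dfl.
rewrite -x0; apply/is_derive_line; rewrite x0.
split; first exact: diff_derivable dfl0.
by rewrite (deriveE _ dfl0) diff_comp//= -(deriveE _ dl0) dlE /l x0.
Qed.

Lemma nbhs_dist_lt V (x : V) (P : set V) :
  nbhs x P -> exists2 r, 0 < r & forall y, `|y - x| < r -> P y.
Proof.
by move=> /nbhs_normP[r r0 xr]; exists r => // y yr; apply: xr; rewrite /= distrC.
Qed.

Lemma ler_dist_half (x y z e : R) :
  `|x - z| <= e / 2 -> `|y - z| <= e / 2 -> `|x - y| <= e.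
Proof.
move=> xz yz.
by rewrite -(subrKA z) (le_trans (ler_normD _ _))// (splitr e) lerD// distrC.
Qed.

End DirectionalDerivatives.

Section MeanValue.
Context {R : realType}.
Implicit Types V : normedModType R.

Lemma MVT_line V (f : V -> R) (x v : V) (t : R) :
  (forall s : R, `|s| <= `|t| -> derivable f (x + s *: v) v) ->
  exists2 c : R, `|c| <= `|t| & f (x + t *: v) - f x = t * 'D_v f (x + c *: v).
Proof.
move=> df; pose g s := f (x + (s * t) *: v).
have st (s : R) : s \in `[0, 1] -> `|s * t| <= `|t|.
  rewrite in_itv/= => /andP[s0 s1].
  by rewrite normrM ger0_norm// ler_piMl.
have dg (s : R) : s \in `[0, 1] ->
    is_derive s (1 : R) g ('D_v f (x + (s * t) *: v) * t).
  move=> /st /df /derivableP /is_derive_line dfs.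
  have dM : is_derive s (1 : R) ( *%R^~ t) t.
    by apply: is_derive_eq; rewrite scaler0 add0r [_ *: 1]mulr1.
  exact: (@is_derive1_comp _ (fun r => f (x + r *: v)) ( *%R^~ t) _ _ _ dfs dM).
have dg_oo (s : R) : s \in `]0, 1[ ->
    is_derive s (1 : R) g ('D_v f (x + (s * t) *: v) * t).
  by move=> s01; apply: dg; exact: subset_itv_oo_cc.
have cg : {within `[0, 1], continuous g}.
  by apply: derivable_within_continuous => s /dg[].
have [c c01 mvt] := MVT_segment ler01 dg_oo cg.
exists (c * t); first exact: st.
by move: mvt; rewrite /g mul1r mul0r scale0r addr0 subr0 mulr1 mulrC.
Qed.

Lemma second_difference_MVT V (f : V -> R) (x u v : V) (r s : R) :
  (forall y, `|y - x| < r -> derivable f y u /\ derivable ('D_u f) y v) ->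
  0 < s -> s * (`|u| + `|v|) < r ->
  exists2 y, `|y - x| < r &
    f (x + s *: u + s *: v) - f (x + s *: u) - f (x + s *: v) + f x =
    s * (s * 'D_v ('D_u f) y).
Proof.
move=> df s0 sr.
have near_x c d : `|c| <= `|s| -> `|d| <= `|s| ->
    `|x + c *: u + d *: v - x| < r.
  move=> cs ds; apply: le_lt_trans sr.
  rewrite -[x + c *: u + _]addrA [x + _]addrC addrK.
  rewrite (le_trans (ler_normD _ _))// mulrDr !normrZ.
  by rewrite -(gtr0_norm s0) lerD// ler_wpM2r// normr_ge0.
pose g y := f (y + s *: v) - f y.
have dg c : `|c| <= `|s| -> is_derive (x + c *: u) u g
    ('D_u f (x + c *: u + s *: v) - 'D_u f (x + c *: u)).
  move=> cs; apply: is_deriveB.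
    apply: (is_derive_translate (f := f)); apply: derivableP.
    by have [] := df _ (near_x _ _ cs (lexx _)).
  apply: derivableP; have n0 : `|0 : R| <= `|s| by rewrite normr0.
  by have [] := df _ (near_x _ _ cs n0); rewrite scale0r addr0.
have [|c cs mvt_u] := @MVT_line _ g x u s; first by move=> c /dg[].
have [|d ds mvt_v] := @MVT_line _ ('D_u f) (x + c *: u) v s.
  by move=> d ds; have [] := df _ (near_x _ _ cs ds).
exists (x + c *: u + d *: v); first exact: near_x.
rewrite -mvt_v -[X in s * X](@derive_val _ _ _ _ _ _ _ (dg _ cs)) -mvt_u /g.
rewrite [x + s *: u + _]addrAC; ring.
Qed.

(* Both iterated derivatives are limits of the second difference of [f] over
   the parallelogram spanned by [s *: u] and [s *: v]. *)
Lemma derive_comm V (f : V -> R) (x u v : V) :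
  (\forall y \near x, derivable f y u) -> (\forall y \near x, derivable f y v) ->
  (\forall y \near x, derivable ('D_u f) y v) ->
  (\forall y \near x, derivable ('D_v f) y u) ->
  {for x, continuous ('D_v ('D_u f))} -> {for x, continuous ('D_u ('D_v f))} ->
  'D_v ('D_u f) x = 'D_u ('D_v f) x.
Proof.
move=> du dv duv dvu cuv cvu; apply/eqP; rewrite -subr_eq0 -normr_le0.
apply/ler_addgt0Pr => e e0; rewrite add0r.
have e2 : 0 < e / 2 by rewrite divr_gt0.
have /cvgrPdist_le /(_ _ e2) near_uv := cuv.
have /cvgrPdist_le /(_ _ e2) near_vu := cvu.
have [r r0 xr] := nbhs_dist_lt
  (filterI (filterI (filterI du duv) (filterI dv dvu)) (filterI near_uv near_vu)).
pose s := r / (2 * (`|u| + `|v| + 1)).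
have d0 : 0 < `|u| + `|v| + 1 by rewrite ltr_wpDl// addr_ge0.
have s0 : 0 < s by rewrite divr_gt0// mulr_gt0.
have sr : s * (`|u| + `|v|) < r.
  rewrite /s mulrAC ltr_pdivrMr ?mulr_gt0// ltr_pM2l//.
  have := normr_ge0 u; have := normr_ge0 v; lra.
have [|y yr diff_uv] := @second_difference_MVT _ f x u v r s _ s0 sr.
  by move=> y /xr[[d _] _]; exact: d.
have [||z zr diff_vu] := @second_difference_MVT _ f x v u r s _ s0 _.
- by move=> z /xr[[_ d] _]; exact: d.
- by rewrite (addrC `|v|).
have yz : 'D_v ('D_u f) y = 'D_u ('D_v f) z.
  apply: (mulfI (lt0r_neq0 s0)); apply: (mulfI (lt0r_neq0 s0)).
  apply: etrans (esym diff_uv) (etrans _ diff_vu); rewrite [x + s *: u + _]addrAC.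
  by congr (_ + _); exact: addrAC.
have [_ [yE _]] := xr _ yr; have [_ [_ zE]] := xr _ zr.
exact: ler_dist_half yE (eq_ind_r (fun w => `|_ - w| <= _) zE yz).
Qed.

End MeanValue.

Lemma mx_norm_entry (K : realDomainType) m n (A : 'M[K]_(m, n)) i j :
  `|A i j| <= `|A|.
Proof.
rewrite [leRHS]/Num.Def.normr/= mx_normrE.
exact: (le_bigmax _ (fun ij => `|A ij.1 ij.2|) (i, j)).
Qed.

Lemma mx_norm_le (K : realDomainType) m n (A : 'M[K]_(m, n)) (r : K) :
  0 <= r -> (forall i j, `|A i j| <= r) -> `|A| <= r.
Proof.
move=> r0 Ar; rewrite [leLHS]/Num.Def.normr/= mx_normrE.
by apply: bigmax_le => // -[i j] _ /=.
Qed.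

Section PartialDerivatives.
Context {R : realType} {n : nat}.
Implicit Types (f : 'rV[R]_n -> R) (y : 'rV[R]_n) (i k : 'I_n).

Definition linear_form (c : 'I_n -> R) y : R := \sum_i y 0 i * c i.

Lemma linear_form_is_linear c : linear (linear_form c : _ -> R^o).
Proof.
move=> k u v; rewrite /linear_form scaler_sumr -big_split/=.
by apply: eq_bigr => i _; rewrite !mxE mulrDl -mulrA.
Qed.

HB.instance Definition _ c :=
  GRing.isLinear.Build R 'rV[R]_n R^o _ (linear_form c) (linear_form_is_linear c).

Lemma continuous_linear_form c : continuous (linear_form c).
Proof.
apply: continuous_big => [|i _ y]; first exact: add_continuous.
apply: (@continuousM _ _ (fun z : 'rV[R]_n => z 0 i) (cst (c i))).
  exact: matrix_normedtype.coord_continuous.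
exact: cst_continuous.
Qed.

(* Telescope along the coordinate axes. *)
Lemma increment_partials f x y :
  (forall z, `|z| <= `|y| -> forall i, derivable f (x + z) (delta_mx 0 i)) ->
  exists z : 'I_n -> 'rV[R]_n, (forall i, `|z i| <= `|y|) /\
    f (x + y) - f x = \sum_i y 0 i * 'D_(delta_mx 0 i) f (x + z i).
Proof.
move=> df; pose w (k : nat) : 'rV[R]_n := \row_i (if (i < k)%N then y 0 i else 0).
have wS k : w k.+1 = w k + y 0 k *: delta_mx 0 k.
  apply/rowP => i; rewrite !mxE eqxx ltnS leq_eqVlt -val_eqE/=.
  by case: ltngtP => //= [ik|ik|/val_inj ->]; rewrite ?mulr1 ?mulr0 ?addr0 ?add0r.
have step k : exists z : 'rV[R]_n, `|z| <= `|y| /\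
    f (x + w k.+1) - f (x + w k) = y 0 k * 'D_(delta_mx 0 k) f (x + z).
  have wc c : `|c| <= `|y 0 k| -> `|w k + c *: delta_mx 0 k| <= `|y|.
    move=> cy; apply: mx_norm_le => // i0 i; rewrite (ord1 i0) !mxE eqxx/=.
    case: ltngtP => [ik|ik|/val_inj ->].
    - by rewrite -val_eqE (ltn_eqF ik) mulr0 addr0 mx_norm_entry.
    - by rewrite -val_eqE (gtn_eqF ik) mulr0 addr0 normr0.
    - by rewrite eqxx mulr1 add0r (le_trans cy) ?mx_norm_entry.
  have [|c cy mvt] := @MVT_line _ _ f (x + w k) (delta_mx 0 k) (y 0 k).
    by move=> s sy; rewrite -addrA; apply: df; exact: wc.
  exists (w k + c *: delta_mx 0 k); split; first exact: wc.
  by rewrite wS !addrA mvt.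
have [z zP] := choice step.
exists z; split; first by move=> i; have [] := zP i.
have w0 : w 0%N = 0 by apply/rowP => i; rewrite !mxE.
have wn : w n = y by apply/rowP => i; rewrite !mxE ltn_ord.
rewrite -{1}wn -[in f x](addr0 x) -w0.
rewrite -(@telescope_sumr _ 0 n (fun k : nat => f (x + w k))) // big_mkord.
by apply: eq_bigr => i _; have [] := zP i.
Qed.

Lemma increment_linear_form_le f x y (e : R) :
  (forall z, `|z| <= `|y| -> forall i, derivable f (x + z) (delta_mx 0 i) /\
     `|'D_(delta_mx 0 i) f x - 'D_(delta_mx 0 i) f (x + z)| <= e) ->
  `|f (x + y) - f x - linear_form (fun i => 'D_(delta_mx 0 i) f x) y|
    <= n%:R * (`|y| * e).
Proof.
move=> df; have [|z [zy ->]] := @increment_partials f x y.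
  by move=> z /df dfz i; have [] := dfz i.
rewrite -sumrB (le_trans (ler_norm_sum _ _ _))//.
apply: (@le_trans _ _ (\sum_(i < n) `|y| * e)).
  apply: ler_sum => i _; rewrite -mulrBr normrM ler_pM ?mx_norm_entry// distrC.
  by have [] := df _ (zy i) i.
by rewrite sumr_const card_ord mulr_natl.
Qed.

Lemma differentiable_partials f x :
  (\forall y \near x, forall i, derivable f y (delta_mx 0 i)) ->
  (forall i, {for x, continuous ('D_(delta_mx 0 i) f)}) ->
  differentiable f x.
Proof.
move=> df cf; pose L := linear_form (fun i => 'D_(delta_mx 0 i) f x).
have fL : f \o shift x = cst (f x) + (L : _ -> R) +o_ 0 id; last first.
  have dE := diff_unique (@continuous_linear_form _) fL.
  by apply/diff_locallyP; rewrite dE; split=> //; exact: continuous_linear_form.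
apply/eqaddoP => _/posnumP[e]; pose e' := e%:num / n.+1%:R.
have e'0 : 0 < e' by rewrite divr_gt0.
pose close i y := derivable f y (delta_mx 0 i) /\
  `|'D_(delta_mx 0 i) f x - 'D_(delta_mx 0 i) f y| <= e'.
have near_x : \forall y \near x, forall i, close i y.
  apply: (@filter_forall _ _ close (nbhs x) _) => i; apply: filterI.
    by apply: filterS df => y /(_ i).
  by have /cvgrPdist_le := cf i; apply.
move: near_x => /nbhs_dist_lt[r r0 xr]; rewrite /= ?near_simpl.
apply/nbhs_norm0P; exists r => // y /= yr.
have -> : (f \o shift x - (cst (f x) + (L : _ -> R))) y = f (x + y) - f x - L y.
  rewrite -![(_ - _ : _ -> _) _]/(_ - _) -![(_ + _ : _ -> _) _]/(_ + _) /=.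
  by rewrite opprD addrA addrC [x + y]addrC addrC.
apply: (le_trans (increment_linear_form_le (e := e') _)).
  by move=> z zy; apply: xr; rewrite addrAC subrr add0r (le_lt_trans zy).
rewrite mulrCA mulrC ler_wpM2r// /e' mulrCA ler_piMr// ler_pdivrMr//.
by rewrite mul1r ler_nat.
Qed.

Lemma is_derive_chain m f (c : 'rV[R]_m -> 'rV[R]_n) (x v : 'rV[R]_m)
    (dc : 'I_n -> R) :
  differentiable f (c x) ->
  (forall k, is_derive x v (fun u => c u 0 k) (dc k)) ->
  is_derive x v (f \o c) (\sum_k dc k * 'D_(delta_mx 0 k) f (c x)).
Proof.
move=> df ddc; have cx : derivable c x v.
  by apply/derivable_mxP => i k; rewrite (ord1 i); have [] := ddc k.
have dcx : is_derive x v c (\row_k dc k).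
  split=> //; rewrite derive_mx//; apply/rowP => k; rewrite !mxE.
  by have [_] := ddc k.
have /is_derive_eq := is_derive_diff_comp df dcx; apply.
rewrite (row_sum_delta (\row_k dc k)) linear_sum; apply: eq_bigr => k _.
by rewrite linearZ/= mxE -deriveE.
Qed.

End PartialDerivatives.

Section PartialDerivativesInCharts.
Context {R : realType} {m : nat} {M : manifold R m}.
Implicit Types (a : chart M) (p q : M) (U : set M) (f g : M -> R).

Definition is_pd a (i : 'I_m) f p (v : R) :=
  is_derive (coord a p) (delta_mx 0 i) (f \o point a) v.

Lemma pd_val a i f p v : is_pd a i f p v -> pd a i f p = v.
Proof. by case. Qed.

Lemma is_pdP a i f p : derivable (f \o point a) (coord a p) (delta_mx 0 i) ->
  is_pd a i f p (pd a i f p).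
Proof. exact: derivableP. Qed.

Lemma is_pd_pd a i f p v : is_pd a i f p v -> is_pd a i f p (pd a i f p).
Proof. by move=> fv; rewrite (pd_val fv). Qed.

Lemma is_pd_eq a i f p v w : is_pd a i f p v -> v = w -> is_pd a i f p w.
Proof. by move=> ? <-. Qed.

Lemma nbhs_dom a p : dom a p -> nbhs p (dom a).
Proof. by move=> ap; apply: open_nbhs_nbhs; split=> //; exact: dom_open. Qed.

Lemma near_point a p U : dom a p -> nbhs p U ->
  \forall x \near coord a p, U (point a x).
Proof.
move=> ap pU; apply: (point_continuous ap).
by rewrite coordK.
Qed.

Lemma near_coord a p U : dom a p -> nbhs p U ->
  \forall x \near coord a p, exists2 q, U q & x = coord a q.
Proof.
move=> ap pU; have ca : \forall x \near coord a p, (coord a @` dom a) x.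
  by apply: open_nbhs_nbhs; split; [exact: image_open|exists p].
near=> x; have [q aq qx] : (coord a @` dom a) x by near: x.
exists q => //; rewrite -(coordK aq) qx.
by near: x; exact: near_point.
Unshelve. all: by end_near. Qed.

Lemma continuous_near_point a p f (F : 'rV[R]_m -> R) : dom a p ->
  {for p, continuous f} -> (\forall x \near coord a p, F x = f (point a x)) ->
  {for coord a p, continuous F}.
Proof.
move=> ap cf Ff; rewrite /prop_for /continuous_at (nbhs_singleton Ff) coordK//.
have c : (f \o point a) x @[x --> coord a p] --> f p.
  apply: (@cvg_comp _ _ _ _ _ _ (nbhs p)) cf.
  by have := point_continuous ap; rewrite /prop_for /continuous_at coordK.
have fF : \forall x \near coord a p, (f \o point a) x = F x.
  by apply: filterS Ff => x ->.
exact: cvg_trans (near_eq_cvg fF) c.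
Qed.

Lemma near_is_pd a i f g p v : dom a p -> (\forall q \near p, f q = g q) ->
  is_pd a i f p v -> is_pd a i g p v.
Proof.
move=> ap fg; apply: near_eq_is_derive.
exact: (@near_point _ _ (fun q => f q = g q)).
Qed.

Lemma near_pd a i f g p : dom a p -> (\forall q \near p, f q = g q) ->
  pd a i f p = pd a i g p.
Proof.
move=> ap fg; apply: near_eq_derive.
exact: (@near_point _ _ (fun q => f q = g q)).
Qed.

Lemma eq_dom_pd a i f g p : dom a p -> (forall q, dom a q -> f q = g q) ->
  pd a i f p = pd a i g p.
Proof. by move=> ap fg; apply: near_pd => //; apply: filterS (nbhs_dom ap). Qed.

Lemma near_derive_pd a i f p : dom a p ->
  \forall x \near coord a p,
    'D_(delta_mx 0 i) (f \o point a) x = pd a i f (point a x).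
Proof.
move=> ap; apply: filterS (near_coord ap (nbhs_dom ap)) => _ [q aq ->].
by rewrite coordK.
Qed.

Lemma is_pd_cst a i p c : is_pd a i (cst c) p 0.
Proof. exact: is_derive_cst. Qed.

Lemma is_pdD a i f g p v w : is_pd a i f p v -> is_pd a i g p w ->
  is_pd a i (fun q => f q + g q) p (v + w).
Proof. exact: is_deriveD. Qed.

Lemma is_pdN a i f p v : is_pd a i f p v -> is_pd a i (fun q => - f q) p (- v).
Proof. exact: is_deriveN. Qed.

Lemma is_pdB a i f g p v w : is_pd a i f p v -> is_pd a i g p w ->
  is_pd a i (fun q => f q - g q) p (v - w).
Proof. exact: is_deriveB. Qed.

Lemma is_pdM a i f g p v w : dom a p -> is_pd a i f p v -> is_pd a i g p w ->
  is_pd a i (fun q => f q * g q) p (v * g p + f p * w).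
Proof.
move=> ap fv gw; have /is_derive_eq := is_deriveM fv gw; apply.
by rewrite /= coordK// addrC; congr (_ + _); rewrite mulrC.
Qed.

Lemma is_pdZ a i f p v c : dom a p -> is_pd a i f p v ->
  is_pd a i (fun q => c * f q) p (c * v).
Proof.
move=> ap fv; apply: is_pd_eq (is_pdM ap (is_pd_cst a i p c) fv) _.
by rewrite mul0r add0r.
Qed.

Lemma is_pd_sum a i p n (F : 'I_n -> M -> R) v :
  (forall k, is_pd a i (F k) p (v k)) ->
  is_pd a i (fun q => \sum_k F k q) p (\sum_k v k).
Proof.
move=> Fv; have := is_derive_sum Fv; rewrite /is_pd.
suff -> : \sum_(k < n) (F k \o point a) = (fun q => \sum_k F k q) \o point a by [].
by apply/funext => x; rewrite fct_sumE.
Qed.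

Lemma is_pdV a i f p v : dom a p -> f p != 0 -> is_pd a i f p v ->
  is_pd a i (fun q => (f q)^-1) p (- ((f p)^-1 * (f p)^-1) * v).
Proof.
move=> ap f0 [df <-].
have f0' : (f \o point a) (coord a p) != 0 by rewrite /= coordK.
split; first exact: (@derivableV _ _ (f \o point a)).
by rewrite (@deriveV _ _ (f \o point a))//= coordK// -invfM.
Qed.

End PartialDerivativesInCharts.

Section DifferentiabilityClasses.
Context {R : realType} {m : nat} {M : manifold R m} (a : chart M) (U : set M).
Hypotheses (oU : open U) (Ua : U `<=` dom a).
Implicit Types (p q : M) (f g : M -> R) (k : nat).

Let nU p : U p -> nbhs p U.
Proof. by move=> Up; apply: open_nbhs_nbhs. Qed.

Lemma Ck_continuous k f p : Ck a U k f -> U p -> {for p, continuous f}.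
Proof. by case: k => [|k] [cf _]; exact: cf. Qed.

Lemma Ck_is_pd k f i p : Ck a U k.+1 f -> U p -> is_pd a i f p (pd a i f p).
Proof. by move=> [_ /(_ i)[df _]] Up; apply: is_pdP; exact: df. Qed.

Lemma Ck_pd k f i : Ck a U k.+1 f -> Ck a U k (pd a i f).
Proof. by move=> [_ /(_ i)[]]. Qed.

Lemma CkW k f : Ck a U k.+1 f -> Ck a U k f.
Proof.
elim: k f => [|k ih] f [cf df]; split=> // i.
by have [dfi Cfi] := df i; split=> //; exact: ih.
Qed.

Lemma eq_Ck k f g : (forall p, U p -> f p = g p) -> Ck a U k f -> Ck a U k g.
Proof.
have near_fg f' g' p : (forall q, U q -> f' q = g' q) -> U p ->
    \forall q \near p, f' q = g' q.
  by move=> fg Up; apply: filterS (nU Up).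
have cont_fg f' g' p : (forall q, U q -> f' q = g' q) -> U p ->
    {for p, continuous f'} -> {for p, continuous g'}.
  move=> fg Up; rewrite /prop_for /continuous_at (fg _ Up) => cf.
  by apply: cvg_trans cf; apply: near_eq_cvg; exact: near_fg.
elim: k f g => [|k ih] f g fg [cf df]; split=> //.
- by move=> p Up; exact: cont_fg fg Up (cf _ Up).
- by move=> p Up; exact: cont_fg fg Up (cf _ Up).
- move=> i; have [dfi Cfi] := df i; split.
    move=> p Up.
    by have [] := near_is_pd (Ua Up) (near_fg _ _ _ fg Up) (is_pdP (dfi _ Up)).
  by apply: ih Cfi => p Up; apply: near_pd; [exact: Ua|exact: near_fg].
Qed.

Lemma Ck0 f : (forall p, U p -> {for p, continuous f}) -> Ck a U 0 f.
Proof. by []. Qed.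

Lemma CkS k f (df : 'I_m -> M -> R) :
  (forall p, U p -> {for p, continuous f}) ->
  (forall i p, U p -> is_pd a i f p (df i p)) ->
  (forall i, Ck a U k (df i)) -> Ck a U k.+1 f.
Proof.
move=> cf dfE Cdf; split=> // i; split=> [p Up|]; first by have [] := dfE i p Up.
by apply: eq_Ck (Cdf i) => p Up; rewrite (pd_val (dfE i p Up)).
Qed.

Lemma Ck_cst k c : Ck a U k (cst c).
Proof.
elim: k c => [|k ih] c; first by apply: Ck0 => p _; exact: cst_continuous.
apply: (CkS _ _ (fun=> ih 0)) => [p _|i p _]; first exact: cst_continuous.
exact: is_pd_cst.
Qed.

Lemma CkD k f g : Ck a U k f -> Ck a U k g -> Ck a U k (fun q => f q + g q).
Proof.
have cD n f' g' p : Ck a U n f' -> Ck a U n g' -> U p ->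
    {for p, continuous (fun q => f' q + g' q)}.
  move=> Cf' Cg' Up; apply: (@continuousD _ _ _ f' g').
    exact: Ck_continuous Cf' Up.
  exact: Ck_continuous Cg' Up.
elim: k f g => [|k ih] f g Cf Cg; first by apply: Ck0 => p; exact: cD Cf Cg.
apply: (CkS _ _ (fun i => ih _ _ (Ck_pd i Cf) (Ck_pd i Cg))) => [p|i p Up].
  exact: cD Cf Cg.
exact: is_pdD (Ck_is_pd i Cf Up) (Ck_is_pd i Cg Up).
Qed.

Lemma CkM k f g : Ck a U k f -> Ck a U k g -> Ck a U k (fun q => f q * g q).
Proof.
have cM n f' g' p : Ck a U n f' -> Ck a U n g' -> U p ->
    {for p, continuous (fun q => f' q * g' q)}.
  move=> Cf' Cg' Up; apply: (@continuousM _ _ f' g').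
    exact: Ck_continuous Cf' Up.
  exact: Ck_continuous Cg' Up.
elim: k f g => [|k ih] f g Cf Cg; first by apply: Ck0 => p; exact: cM Cf Cg.
apply: (CkS _ _ (fun i => CkD (ih _ _ (Ck_pd i Cf) (CkW Cg))
  (ih _ _ (CkW Cf) (Ck_pd i Cg)))) => [p|i p Up]; first exact: cM Cf Cg.
exact: is_pdM (Ua Up) (Ck_is_pd i Cf Up) (Ck_is_pd i Cg Up).
Qed.

Lemma CkZ k f c : Ck a U k f -> Ck a U k (fun q => c * f q).
Proof. exact: (CkM (Ck_cst k c)). Qed.

Lemma CkN k f : Ck a U k f -> Ck a U k (fun q => - f q).
Proof. by move=> /(CkZ (-1)); apply: eq_Ck => p _; rewrite mulN1r. Qed.

Lemma CkB k f g : Ck a U k f -> Ck a U k g -> Ck a U k (fun q => f q - g q).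
Proof. by move=> Cf /CkN; exact: CkD. Qed.

Lemma Ck_sum k (I : finType) (F : I -> M -> R) :
  (forall i, Ck a U k (F i)) -> Ck a U k (fun q => \sum_i F i q).
Proof.
move=> CF; elim: (index_enum I) => [|i s ih].
  by apply: eq_Ck (Ck_cst k 0) => p _; rewrite big_nil.
by apply: eq_Ck (CkD (CF i) ih) => p _; rewrite big_cons.
Qed.

Lemma Ck_prod k (I : finType) (F : I -> M -> R) :
  (forall i, Ck a U k (F i)) -> Ck a U k (fun q => \prod_i F i q).
Proof.
move=> CF; elim: (index_enum I) => [|i s ih].
  by apply: eq_Ck (Ck_cst k 1) => p _; rewrite big_nil.
by apply: eq_Ck (CkM (CF i) ih) => p _; rewrite big_cons.
Qed.

Lemma CkV k f : (forall p, U p -> f p != 0) -> Ck a U k f ->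
  Ck a U k (fun q => (f q)^-1).
Proof.
move=> f0; have cV n p : Ck a U n f -> U p ->
    {for p, continuous (fun q => (f q)^-1)}.
  by move=> Cf Up; apply: cvgV; [exact: f0|exact: Ck_continuous Cf Up].
elim: k => [|k ih] Cf; first by apply: Ck0 => p; exact: cV Cf.
have Cf' := ih (CkW Cf).
apply: (CkS _ _ (fun i => CkM (CkN (CkM Cf' Cf')) (Ck_pd i Cf))) => [p|i p Up].
  exact: cV Cf.
exact: is_pdV (Ua Up) (f0 _ Up) (Ck_is_pd i Cf Up).
Qed.

Lemma Ck_det k n (A : M -> 'M[R]_n) :
  (forall i j, Ck a U k (fun q => A q i j)) -> Ck a U k (fun q => \det (A q)).
Proof.
move=> CA; apply: Ck_sum => s; apply: CkZ.
by apply: Ck_prod => i; exact: CA.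
Qed.

Lemma Ck_adjugate k n (A : M -> 'M[R]_n) :
  (forall i j, Ck a U k (fun q => A q i j)) ->
  forall i j, Ck a U k (fun q => (\adj (A q)) i j).
Proof.
move=> CA i j.
apply: (@eq_Ck k (fun q => cofactor (A q) j i)) => [p _|]; first by rewrite mxE.
apply: CkZ; apply: Ck_det => i' j'.
apply: (@eq_Ck k (fun q => A q (fintype.lift j i') (fintype.lift i j'))) => //.
by move=> p _; rewrite !mxE.
Qed.

Lemma Ck_invmx k n (A : M -> 'M[R]_n) :
  (forall p, U p -> A p \in unitmx) ->
  (forall i j, Ck a U k (fun q => A q i j)) ->
  forall i j, Ck a U k (fun q => invmx (A q) i j).
Proof.
move=> uA CA i j; have d0 p : U p -> \det (A p) != 0.
  by move=> /uA; rewrite unitmxE unitfE.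
apply: eq_Ck (CkM (CkV d0 (Ck_det CA)) (Ck_adjugate CA i j)) => p Up.
by rewrite /invmx uA// [RHS]mxE.
Qed.

Lemma Ck_derivable k f i p : Ck a U k.+1 f -> U p ->
  \forall x \near coord a p, derivable (f \o point a) x (delta_mx 0 i).
Proof.
move=> Cf Up; apply: filterS (near_coord (Ua Up) (nU Up)) => _ [q Uq ->].
by have [] := Ck_is_pd i Cf Uq.
Qed.

Lemma Ck_continuous_derive k f i p : Ck a U k.+1 f -> U p ->
  {for coord a p, continuous ('D_(delta_mx 0 i) (f \o point a))}.
Proof.
move=> Cf Up; apply: continuous_near_point (Ck_continuous (Ck_pd i Cf) Up) _.
  exact: Ua.
by apply: near_derive_pd; exact: Ua.
Qed.

Lemma Ck_differentiable k f p : Ck a U k.+1 f -> U p ->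
  differentiable (f \o point a) (coord a p).
Proof.
move=> Cf Up; apply: differentiable_partials => [|i].
  apply: filterS (near_coord (Ua Up) (nU Up)) => _ [q Uq ->] i.
  by have [] := Ck_is_pd i Cf Uq.
exact: Ck_continuous_derive Cf Up.
Qed.

Lemma pd_comm f p i j : Ck a U 2 f -> U p ->
  pd a i (pd a j f) p = pd a j (pd a i f) p.
Proof.
move=> Cf Up; have ap := Ua Up; pose F := f \o point a.
have near_pd2 (l : 'I_m) q : U q -> \forall x \near coord a q,
    (pd a l f \o point a) x = 'D_(delta_mx 0 l) F x.
  by move=> /Ua aq; apply: filterS (near_derive_pd l f aq) => x.
have pd2 (l r : 'I_m) q : U q -> is_derive (coord a q) (delta_mx 0 l)
    ('D_(delta_mx 0 r) F) (pd a l (pd a r f) q).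
  move=> Uq; apply: near_eq_is_derive (near_pd2 r q Uq) _.
  exact: Ck_is_pd (Ck_pd r Cf) Uq.
have d2 (l r : 'I_m) : \forall x \near coord a p,
    derivable ('D_(delta_mx 0 r) F) x (delta_mx 0 l).
  by apply: filterS (near_coord ap (nU Up)) => _ [q Uq ->]; have [] := pd2 l r q Uq.
have c2 (l r : 'I_m) : {for coord a p, continuous
    ('D_(delta_mx 0 l) ('D_(delta_mx 0 r) F))}.
  apply: (continuous_near_point ap (Ck_continuous (Ck_pd l (Ck_pd r Cf)) Up)).
  apply: filterS (near_coord ap (nU Up)) => _ [q Uq ->].
  by rewrite (@derive_val _ _ _ _ _ _ _ (pd2 l r q Uq)) coordK//; exact: Ua.
rewrite -(@derive_val _ _ _ _ _ _ _ (pd2 i j p Up)).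
rewrite -(@derive_val _ _ _ _ _ _ _ (pd2 j i p Up)).
by apply: derive_comm => //; exact: Ck_derivable Cf Up.
Qed.

End DifferentiabilityClasses.

Lemma is_pd_comp (R : realType) m n (M : manifold R m) (N : manifold R n)
    (phi : M -> N) (a : chart M) (b : chart N) V F mu p :
  dom a p -> {for p, continuous phi} ->
  open V -> V `<=` dom b -> V (phi p) -> Ck b V 1 F ->
  (forall k, derivable ((fun q => coord b (phi q) 0 k) \o point a) (coord a p)
     (delta_mx 0 mu)) ->
  is_pd a mu (F \o phi) p (\sum_k dphi phi a b mu k p * pd b k F (phi p)).
Proof.
move=> ap cphi oV Vb Vp CF dphi'; pose c x := coord b (phi (point a x)).
have dF : differentiable (F \o point b) (c (coord a p)).
  by rewrite /c coordK//; exact: Ck_differentiable CF Vp.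
have := is_derive_chain dF (fun k => derivableP (dphi' k)).
under eq_bigr => k _ do rewrite /c (coordK ap).
apply: near_eq_is_derive.
have nV : nbhs p (phi @^-1` V) by apply: cphi; apply: open_nbhs_nbhs.
apply: filterS (near_point ap nV) => x Vx.
by rewrite /= /c coordK//; exact: Vb.
Qed.

Section ComplexPartialDerivatives.
Context {R : realType} {m : nat} {M : manifold R m}.
Implicit Types (a : chart M) (p q : M) (f g : M -> R[i]).

Definition is_pdC a (i : 'I_m) f p (v : R[i]) :=
  is_pd a i (fun q => complex.Re (f q)) p (complex.Re v) /\
  is_pd a i (fun q => complex.Im (f q)) p (complex.Im v).

Lemma pdC_val a i f p v : is_pdC a i f p v -> pdC a i f p = v.
Proof. by rewrite /pdC => -[/pd_val -> /pd_val ->]; case: v. Qed.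

Lemma is_pdC_pdC a i f p v : is_pdC a i f p v -> is_pdC a i f p (pdC a i f p).
Proof. by move=> fv; rewrite (pdC_val fv). Qed.

Lemma is_pdC_eq a i f p v w : is_pdC a i f p v -> v = w -> is_pdC a i f p w.
Proof. by move=> ? <-. Qed.

Lemma eq_is_pdC a i f g p v : f =1 g -> is_pdC a i f p v -> is_pdC a i g p v.
Proof. by move=> /funext ->. Qed.

Lemma is_pdC_cst a i p c : is_pdC a i (cst c) p 0.
Proof. by split; exact: is_pd_cst. Qed.

Lemma is_pdC_real a i (f : M -> R) p v : is_pd a i f p v ->
  is_pdC a i (fun q => (f q)%:C) p v%:C.
Proof. by move=> fv; split=> //; exact: is_pd_cst. Qed.

Lemma is_pdC_conj a i f p v : is_pdC a i f p v ->
  is_pdC a i (fun q => conjc (f q)) p (conjc v).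
Proof.
move=> [fr fi]; split.
  have -> : (fun q => complex.Re (conjc (f q))) = (fun q => complex.Re (f q)).
    by apply/funext => q; case: (f q).
  by case: v fr {fi}.
have -> : (fun q => complex.Im (conjc (f q))) = (fun q => - complex.Im (f q)).
  by apply/funext => q; case: (f q).
by move: fi => /is_pdN; case: v {fr}.
Qed.

Lemma is_pdCD a i f g p v w : is_pdC a i f p v -> is_pdC a i g p w ->
  is_pdC a i (fun q => f q + g q) p (v + w).
Proof.
move=> [fr fi] [gr gi]; split.
  have -> : (fun q => complex.Re (f q + g q)) =
      (fun q => complex.Re (f q) + complex.Re (g q)).
    by apply/funext => q; case: (f q); case: (g q).
  by have := is_pdD fr gr; case: v {fr fi} => ? ?; case: w {gr gi}.
have -> : (fun q => complex.Im (f q + g q)) =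
    (fun q => complex.Im (f q) + complex.Im (g q)).
  by apply/funext => q; case: (f q); case: (g q).
by have := is_pdD fi gi; case: v {fr fi} => ? ?; case: w {gr gi}.
Qed.

Lemma is_pdCM a i f g p v w : dom a p -> is_pdC a i f p v -> is_pdC a i g p w ->
  is_pdC a i (fun q => f q * g q) p (v * g p + f p * w).
Proof.
move=> ap [fr fi] [gr gi]; split.
  have -> : (fun q => complex.Re (f q * g q)) = (fun q => complex.Re (f q) *
      complex.Re (g q) - complex.Im (f q) * complex.Im (g q)).
    by apply/funext => q; case: (f q) => ? ?; case: (g q).
  apply: is_pd_eq (is_pdB (is_pdM ap fr gr) (is_pdM ap fi gi)) _.
  by case: v {fr fi} => ? ?; case: w {gr gi} => ? ?;
    case: (f p) => ? ?; case: (g p) => ? ? /=; ring.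
have -> : (fun q => complex.Im (f q * g q)) = (fun q => complex.Re (f q) *
    complex.Im (g q) + complex.Im (f q) * complex.Re (g q)).
  by apply/funext => q; case: (f q) => ? ?; case: (g q).
apply: is_pd_eq (is_pdD (is_pdM ap fr gi) (is_pdM ap fi gr)) _.
by case: v {fr fi} => ? ?; case: w {gr gi} => ? ?;
  case: (f p) => ? ?; case: (g p) => ? ? /=; ring.
Qed.

Lemma is_pdCZ a i f p v c : dom a p -> is_pdC a i f p v ->
  is_pdC a i (fun q => c * f q) p (c * v).
Proof.
move=> ap fv; apply: is_pdC_eq (is_pdCM ap (is_pdC_cst a i p c) fv) _.
by rewrite mul0r add0r.
Qed.

Lemma is_pdCB a i f g p v w : dom a p -> is_pdC a i f p v -> is_pdC a i g p w ->
  is_pdC a i (fun q => f q - g q) p (v - w).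
Proof.
move=> ap fv gw; have := is_pdCD fv (is_pdCZ (-1) ap gw); rewrite mulN1r.
by apply: eq_is_pdC => q; rewrite mulN1r.
Qed.

Lemma is_pdC_sum a i p n (F : 'I_n -> M -> R[i]) v :
  (forall k, is_pdC a i (F k) p (v k)) ->
  is_pdC a i (fun q => \sum_k F k q) p (\sum_k v k).
Proof.
move=> Fv; elim: (index_enum _) => [|k s ih].
  rewrite big_nil; apply: eq_is_pdC (is_pdC_cst a i p 0) => q.
  by rewrite big_nil.
by rewrite big_cons; apply: eq_is_pdC (is_pdCD (Fv k) ih) => q; rewrite big_cons.
Qed.

Lemma smoothC_is_pdC a i f p (U : set M) : smoothC_on U f -> U p -> dom a p ->
  is_pdC a i f p (pdC a i f p).
Proof.
move=> [fr fi] Up ap.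
by split; [exact: Ck_is_pd (fr a 1%N) _|exact: Ck_is_pd (fi a 1%N) _].
Qed.

Lemma is_pdC_mulmx a i p k l (A : 'M[R[i]]_(k, l)) (u : M -> 'cV[R[i]]_l)
    (v : 'cV[R[i]]_l) r :
  dom a p -> (forall s, is_pdC a i (fun q => u q s 0) p (v s 0)) ->
  is_pdC a i (fun q => (A *m u q) r 0) p ((A *m v) r 0).
Proof.
move=> ap uv; rewrite mxE.
apply: (@eq_is_pdC _ _ (fun q => \sum_s A r s * u q s 0)).
  by move=> q; rewrite mxE.
by apply: is_pdC_sum => s; exact: is_pdCZ.
Qed.

Lemma is_pdC_herm a i p d (u w : M -> 'cV[R[i]]_d) (du dw : 'cV[R[i]]_d) :
  dom a p ->
  (forall s, is_pdC a i (fun q => u q s 0) p (du s 0)) ->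
  (forall s, is_pdC a i (fun q => w q s 0) p (dw s 0)) ->
  is_pdC a i (fun q => herm (u q) (w q)) p (herm du (w p) + herm (u p) dw).
Proof.
move=> ap pdu pdw; rewrite /herm -big_split/=; apply: is_pdC_sum => s.
by apply: is_pdCM => //; exact: is_pdC_conj.
Qed.

End ComplexPartialDerivatives.

Section HermitianProduct.
Context {R : realType} {d : nat}.
Implicit Types (u v w : 'cV[R[i]]_d) (c : R[i]) (A : 'M[R[i]]_d).

Lemma herm_is_sesquilinear :
  bilinear_for (GRing.Scale.Law.clone _ _ (@conjc R \; *%R) _)
    (GRing.Scale.Law.clone _ _ *%R _) (@herm R d).
Proof.
by split=> [w|w] c u v; rewrite /herm /= mulr_sumr -big_split/=;
  apply: eq_bigr => i _; rewrite !mxE ?rmorphD ?rmorphM/=; ring.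
Qed.

HB.instance Definition _ := bilinear_isBilinear.Build R[i] 'cV[R[i]]_d 'cV[R[i]]_d
  R[i] _ _ (@herm R d) herm_is_sesquilinear.

Lemma hermZl c u v : herm (c *: u) v = conjc c * herm u v.
Proof. exact: linearZl_LR. Qed.

Lemma hermZr c u v : herm u (c *: v) = c * herm u v.
Proof. exact: linearZr_LR. Qed.

Lemma herm_conj u v : conjc (herm u v) = herm v u.
Proof.
rewrite /herm rmorph_sum; apply: eq_bigr => i _.
by rewrite rmorphM /= conjcK mulrC.
Qed.

Lemma herm_mull A u v : herm (A *m u) v = herm u ((map_mx (@conjc R) A)^T *m v).
Proof.
rewrite /herm; under eq_bigr => i _ do rewrite mxE rmorph_sum mulr_suml.
rewrite exchange_big; apply: eq_bigr => j _ /=.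
rewrite mxE mulr_sumr; apply: eq_bigr => i _.
by rewrite rmorphM !mxE [_ * conjc (u _ _)]mulrC mulrA.
Qed.

End HermitianProduct.

Lemma sum_deltaZ (R : pzRingType) (V : lmodType R) n (F : 'I_n -> V) k :
  \sum_l (k == l)%:R *: F l = F k.
Proof.
rewrite (bigD1 k)//= eqxx scale1r big1 ?addr0// => l lk.
by rewrite eq_sym (negbTE lk) scale0r.
Qed.

Section SpinRepresentation.
Context {R : realType} {m : nat} (gam : clifford_rep R m).
Implicit Types (u v : 'cV[R[i]]_(spdim m)) (al be ga : 'I_m).

Lemma herm_gam al u v : herm (gam al *m u) v = - herm u (gam al *m v).
Proof. by rewrite herm_mull gam_skew mulNmx; exact: linearNr. Qed.

Lemma gam_comm_gam2 al be ga :
  gam al *m (gam be *m gam ga) - gam be *m gam ga *m gam al =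
  - 2 *: ((al == be)%:R *: gam ga - (al == ga)%:R *: gam be).
Proof.
transitivity ((gam al *m gam be + gam be *m gam al) *m gam ga -
    gam be *m (gam al *m gam ga + gam ga *m gam al)).
  by rewrite mulmxDl mulmxDr !mulmxA opprD addrA addrK.
by rewrite !clifford mul_scalar_mx mul_mx_scalar scalerBr !scalerA.
Qed.

Variable om : 'I_m -> 'I_m -> R.
Hypothesis om_skew : forall be ga, om be ga = - om ga be.

(* The image of [om] under the derivative of the spin representation. *)
Definition spin_matrix : 'M[R[i]]_(spdim m) :=
  4^-1 *: \sum_be \sum_ga (om be ga)%:C *: (gam be *m gam ga).

Lemma spin_matrix_comm al :
  gam al *m spin_matrix - spin_matrix *m gam al =
  - \sum_be (om al be)%:C *: gam be.
Proof.
rewrite /spin_matrix -scalemxAr -scalemxAl -scalerBr.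
rewrite mulmx_sumr mulmx_suml -sumrB.
have row_comm be : gam al *m (\sum_ga (om be ga)%:C *: (gam be *m gam ga)) -
    (\sum_ga (om be ga)%:C *: (gam be *m gam ga)) *m gam al =
    - 2 *: ((al == be)%:R *: (\sum_ga (om be ga)%:C *: gam ga)
            + (om al be)%:C *: gam be).
  rewrite mulmx_sumr mulmx_suml -sumrB scalerDr -(sum_deltaZ (fun ga =>
    (om ga be)%:C *: gam be) al) !scaler_sumr -big_split/=.
  apply: eq_bigr => ga _; rewrite -scalemxAr -scalemxAl -scalerBr gam_comm_gam2.
  rewrite (om_skew ga) rmorphN !scalerBr !scalerA -scaleNr.
  by congr (_ *: _ + _ *: _); ring.
under eq_bigr => be _ do rewrite row_comm.
rewrite -scaler_sumr big_split/= sum_deltaZ -mulr2n.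
rewrite -[X in _ *: (_ *: X)]scaler_nat !scalerA -[RHS]scaleN1r; congr (_ *: _).
by field.
Qed.

Lemma herm_spin_matrix u v :
  herm (spin_matrix *m u) v = - herm u (spin_matrix *m v).
Proof.
rewrite /spin_matrix -!scalemxAl hermZl hermZr rmorphV ?unitfE// rmorph_nat.
rewrite -mulrN; congr (_ * _); rewrite !mulmx_suml linear_sumlz linear_sumr/=.
under eq_bigr => be _ do rewrite mulmx_suml linear_sumlz/=.
under [in RHS]eq_bigr => be _ do rewrite mulmx_suml linear_sumr/=.
rewrite exchange_big/= -sumrN; apply: eq_bigr => be _; rewrite -sumrN.
apply: eq_bigr => ga _; rewrite -!scalemxAl hermZl hermZr conjc_real -!mulmxA.
by rewrite !herm_gam opprK om_skew rmorphN mulNr.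
Qed.

Lemma spin_matrix_herm al u v :
  herm (spin_matrix *m u) (gam al *m v) + herm u (gam al *m (spin_matrix *m v)) =
  - \sum_be (om al be)%:C * herm u (gam be *m v).
Proof.
rewrite herm_spin_matrix addrC !mulmxA -linearBr/= -mulmxBl spin_matrix_comm.
rewrite mulNmx linearNr mulmx_suml linear_sumr/=; congr (- _).
by apply: eq_bigr => be _; rewrite -scalemxAl hermZr.
Qed.

End SpinRepresentation.

Section Contractions.
Variable C : comPzRingType.

Lemma contractA (I J : finType) (u : I -> C) (F : I -> J -> C) (v : J -> C) :
  \sum_i u i * (\sum_j F i j * v j) = \sum_j (\sum_i u i * F i j) * v j.
Proof.
under eq_bigr => i _ do rewrite mulr_sumr.
rewrite exchange_big/=; apply: eq_bigr => j _; rewrite mulr_suml.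
by apply: eq_bigr => i _; rewrite mulrA.
Qed.

Lemma contractA2 (I J K L : finType) (u : I -> J -> C)
    (F : I -> J -> K -> L -> C) (v : K -> L -> C) :
  \sum_i \sum_j u i j * (\sum_k \sum_l F i j k l * v k l) =
  \sum_k \sum_l (\sum_i \sum_j u i j * F i j k l) * v k l.
Proof.
under eq_bigr => i _ do under eq_bigr => j _ do rewrite pair_bigA/=.
rewrite pair_bigA/= [RHS]pair_bigA/=.
rewrite (contractA (fun s => u s.1 s.2) (fun s r => F s.1 s.2 r.1 r.2)).
by apply: eq_bigr => r _; rewrite [in RHS]pair_bigA.
Qed.

Lemma contractA3 (I J K L : finType) (u : I -> J -> K -> C)
    (F : I -> J -> K -> L -> C) (v : L -> C) :
  \sum_i \sum_j \sum_k u i j k * (\sum_l F i j k l * v l) =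
  \sum_l (\sum_i \sum_j \sum_k u i j k * F i j k l) * v l.
Proof.
under [RHS]eq_bigr => l _ do rewrite mulr_suml.
rewrite [RHS]exchange_big/=; apply: eq_bigr => i _.
under [RHS]eq_bigr => l _ do rewrite mulr_suml.
rewrite [RHS]exchange_big/=; apply: eq_bigr => j _.
under [RHS]eq_bigr => l _ do rewrite mulr_suml.
rewrite [RHS]exchange_big/=; apply: eq_bigr => k _.
by rewrite mulr_sumr; apply: eq_bigr => l _; rewrite mulrA.
Qed.

(* The Leibniz rule for the pairing of a vector with a covector does not see the
   connection matrix [A]. *)
Lemma contract_leibniz n (A : 'I_n -> 'I_n -> C) (u du l dl : 'I_n -> C) :
  \sum_i (du i * l i + u i * dl i) =
  \sum_i (du i + \sum_k A i k * u k) * l i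
  + \sum_i u i * (dl i - \sum_k A k i * l k).
Proof.
have A_adjoint : \sum_i u i * (\sum_k A k i * l k) =
    \sum_i (\sum_k A i k * u k) * l i.
  rewrite contractA; apply: eq_bigr => k _; congr (_ * _).
  by apply: eq_bigr => i _; rewrite mulrC.
under [X in _ + X]eq_bigr => i _ do rewrite mulrBr.
under [X in X + _]eq_bigr => i _ do rewrite mulrDl.
rewrite sumrB A_adjoint !big_split/=; ring.
Qed.

Lemma contract_leibniz2 n (A H dH S dS : 'I_n -> 'I_n -> C) :
  \sum_i \sum_j (dH i j * S i j + H i j * dS i j) =
  \sum_i \sum_j (dH i j + \sum_k A i k * H k j + \sum_k A j k * H i k) * S i j
  + \sum_i \sum_j H i j * (dS i j - \sum_k A k i * S k j - \sum_k A k j * S i k).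
Proof.
rewrite exchange_big/=; under eq_bigr => j _ do rewrite (contract_leibniz A
  (fun i => H i j) (fun i => dH i j) (fun i => S i j) (fun i => dS i j)).
rewrite big_split/= exchange_big/= [X in _ + X]exchange_big/= -!big_split/=.
apply: eq_bigr => i _; rewrite -big_split/=.
exact: (contract_leibniz A (H i) (fun j => dH i j + \sum_k A i k * H k j)
  (S i) (fun j => dS i j - \sum_k A k i * S k j)).
Qed.

End Contractions.

Section AffineConnection.
Context {R : realType} {m : nat} {M : manifold R m} (a : chart M).
(* [G k i j] is the coefficient Gamma^k_{ij}. *)
Variable G : 'I_m -> 'I_m -> 'I_m -> M -> R.
Implicit Types (p : M) (i j k l : 'I_m).
Implicit Types (L : 'I_m -> M -> R) (S : 'I_m -> 'I_m -> M -> R).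

Let oa : open (dom a). Proof. exact: dom_open. Qed.
Let aa : dom a `<=` dom a. Proof. by []. Qed.

Definition nabla_covec L i j p : R :=
  pd a i (L j) p - \sum_k G k i j p * L k p.

Definition nabla_bilin S k i j p : R :=
  pd a k (S i j) p - \sum_l G l k i p * S l j p - \sum_l G l k j p * S i l p.

Definition connection_curvature i j l k p : R :=
  pd a i (G k j l) p - pd a j (G k i l) p
  + \sum_q (G k i q p * G q j l p - G k j q p * G q i l p).

Lemma nabla_bilin_skew S p k i j : (forall r s, Ck a (dom a) 1 (S r s)) ->
  (forall q, dom a q -> forall r s, S r s q = - S s r q) -> dom a p ->
  nabla_bilin S k i j p = - nabla_bilin S k j i p.
Proof.
move=> CS SN ap; rewrite /nabla_bilin.
have -> : pd a k (S i j) p = - pd a k (S j i) p.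
  rewrite -(pd_val (is_pdN (Ck_is_pd k (CS j i) ap))).
  by apply: eq_dom_pd => // q aq; exact: SN.
under eq_bigr => l _ do rewrite (SN _ ap) mulrN.
under [X in _ - X]eq_bigr => l _ do rewrite (SN _ ap) mulrN.
rewrite !sumrN; ring.
Qed.

Hypothesis G_Ck : forall n k i j, Ck a (dom a) n (G k i j).

Lemma nabla_covec_Ck n L i j : (forall l, Ck a (dom a) n.+1 (L l)) ->
  Ck a (dom a) n (nabla_covec L i j).
Proof.
move=> CL; apply: CkB => //; first exact: Ck_pd (CL j).
by apply: Ck_sum => // k; apply: CkM => //; exact: CkW (CL k).
Qed.

Lemma pd_nabla_covec L p k i j : (forall l, Ck a (dom a) 2 (L l)) -> dom a p ->
  pd a k (nabla_covec L i j) p = pd a k (pd a i (L j)) p -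
  \sum_q (pd a k (G q i j) p * L q p + G q i j p * pd a k (L q) p).
Proof.
move=> CL ap; apply: pd_val; apply: is_pdB.
  exact: Ck_is_pd (Ck_pd i (CL j)) ap.
apply: is_pd_sum => q; apply: is_pdM => //.
  exact: Ck_is_pd (G_Ck 1 _ _ _) ap.
exact: Ck_is_pd (CkW (CL q)) ap.
Qed.

(* For symmetric [G], all terms but the last are symmetric in [k] and [i]. *)
Lemma nabla2_covec L p k i j : (forall l, Ck a (dom a) 2 (L l)) -> dom a p ->
  nabla_bilin (nabla_covec L) k i j p =
  pd a k (pd a i (L j)) p
  - (\sum_q G q i j p * pd a k (L q) p + \sum_q G q k j p * pd a i (L q) p)
  - \sum_l G l k i p * nabla_covec L l j p
  - \sum_q (pd a k (G q i j) p - \sum_l G q i l p * G l k j p) * L q p.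
Proof.
move=> CL ap; rewrite /nabla_bilin pd_nabla_covec// big_split/=.
have -> : \sum_l G l k j p * nabla_covec L i l p =
    \sum_l G l k j p * pd a i (L l) p
    - \sum_q (\sum_l G q i l p * G l k j p) * L q p.
  under eq_bigr => l _ do rewrite mulrBr.
  rewrite sumrB contractA; congr (_ - _); apply: eq_bigr => q _; congr (_ * _).
  by apply: eq_bigr => l _; rewrite mulrC.
under [X in _ = _ - X]eq_bigr => q _ do rewrite mulrBl.
rewrite sumrB; ring.
Qed.

Hypothesis G_torsion_free : forall p k i j, dom a p -> G k i j p = G k j i p.

Lemma ricci_identity L p k i j : (forall l, Ck a (dom a) 2 (L l)) -> dom a p ->
  nabla_bilin (nabla_covec L) k i j p - nabla_bilin (nabla_covec L) i k j p =
  - \sum_l connection_curvature k i j l p * L l p.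
Proof.
move=> CL ap; rewrite !nabla2_covec// (pd_comm oa aa k i (CL j) ap).
under [X in _ - (_ - X - _)]eq_bigr => l _ do rewrite (G_torsion_free l i k ap).
have -> : \sum_l connection_curvature k i j l p * L l p =
    \sum_q (pd a k (G q i j) p - \sum_l G q i l p * G l k j p) * L q p -
    \sum_q (pd a i (G q k j) p - \sum_l G q k l p * G l i j p) * L q p.
  rewrite -sumrB; apply: eq_bigr => q _; rewrite -mulrBl; congr (_ * _).
  by rewrite /connection_curvature sumrB; ring.
ring.
Qed.

Lemma first_bianchi_identity p i j k l : dom a p ->
  connection_curvature i j k l p + connection_curvature j k i l p
  + connection_curvature k i j l p = 0.
Proof.
move=> ap; have pdGC r s t : pd a r (G l s t) p = pd a r (G l t s) p.
  by apply: eq_dom_pd => // q; exact: G_torsion_free.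
rewrite /connection_curvature (pdGC i k j) (pdGC j k i) (pdGC k j i).
pose GG r s t q := G l r q p * G q s t p.
have quadratic : \sum_q (GG i j k q - GG j i k q) + \sum_q (GG j k i q - GG k j i q)
    + \sum_q (GG k i j q - GG i k j q) = 0.
  rewrite -!big_split/= big1// => q _; rewrite /GG (G_torsion_free q k j ap).
  by rewrite (G_torsion_free q k i ap) (G_torsion_free q j i ap); ring.
by rewrite /GG in quadratic; lra.
Qed.

End AffineConnection.

Section LeviCivita.
Context {R : realType} {m : nat} {M : manifold R m} (g : metric M) (a : chart M).
Implicit Types (p : M) (i j k l r s : 'I_m) (X Y : chart M -> M -> 'rV[R]_m).
Implicit Types (L : 'I_m -> M -> R) (S : 'I_m -> 'I_m -> M -> R).

Let oa : open (dom a). Proof. exact: dom_open. Qed.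
Let aa : dom a `<=` dom a. Proof. by []. Qed.

Lemma metricC p i j : dom a p -> g a p i j = g a p j i.
Proof. by move=> ap; rewrite -[in LHS](metric_sym g ap) mxE. Qed.

Lemma metric_unit p : dom a p -> g a p \in unitmx.
Proof.
move=> ap; rewrite unitmxE unitfE; apply/det0P => -[v v0 vg].
by have := metric_posdef g ap v0; rewrite vg mul0mx mxE ltxx.
Qed.

Lemma metric_Ck n i j : Ck a (dom a) n (fun p => g a p i j).
Proof. by have := metric_smooth g a i j a n; rewrite setIid. Qed.

Lemma metric_is_pd p r i j : dom a p ->
  is_pd a r (fun q => g a q i j) p (pd a r (fun q => g a q i j) p).
Proof. exact: Ck_is_pd (metric_Ck 1 i j). Qed.

Lemma pd_metricC p r i j : dom a p ->
  pd a r (fun q => g a q i j) p = pd a r (fun q => g a q j i) p.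
Proof. by move=> ap; apply: eq_dom_pd => // q; exact: metricC. Qed.

Lemma christoffel_Ck n k i j : Ck a (dom a) n (christoffel g a k i j).
Proof.
apply: CkZ => //; apply: Ck_sum => // l; apply: CkM => //.
  by apply: Ck_invmx => // *; [exact: metric_unit|exact: metric_Ck].
have dg r s q := Ck_pd q (metric_Ck n.+1 r s).
by apply: CkB => //; apply: CkD.
Qed.

Lemma christoffelC p k i j : dom a p ->
  christoffel g a k i j p = christoffel g a k j i p.
Proof.
move=> ap; congr (_ * _); apply: eq_bigr => l _; congr (_ * _).
by rewrite [pd a l _ _]pd_metricC// [X in X - _]addrC.
Qed.

Lemma christoffel_lower p l i j : dom a p ->
  \sum_q g a p l q * christoffel g a q i j p =
  2^-1 * (pd a i (fun x => g a x j l) p + pd a j (fun x => g a x i l) p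
          - pd a l (fun x => g a x i j) p).
Proof.
move=> ap; pose dg : 'cV[R]_m := \col_s (pd a i (fun x => g a x j s) p
  + pd a j (fun x => g a x i s) p - pd a s (fun x => g a x i j) p).
transitivity (2^-1 * (g a p *m (invmx (g a p) *m dg)) l 0).
  rewrite mxE mulr_sumr; apply: eq_bigr => q _; rewrite /christoffel mulrCA mxE.
  by congr (_ * (_ * _)); apply: eq_bigr => s _; rewrite mxE.
by rewrite mulKVmx ?metric_unit// mxE.
Qed.

Lemma metric_compat p r i j : dom a p ->
  pd a r (fun q => g a q i j) p =
  \sum_q christoffel g a q r i p * g a p q j +
  \sum_q christoffel g a q r j p * g a p i q.
Proof.
move=> ap.
under eq_bigr => q _ do rewrite mulrC (metricC _ _ ap).
under [X in _ + X]eq_bigr => q _ do rewrite mulrC.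
rewrite !christoffel_lower// (pd_metricC r j i ap); lra.
Qed.

Lemma innerC p (u v : 'rV[R]_m) : dom a p -> inner g a p u v = inner g a p v u.
Proof.
move=> ap; rewrite /inner exchange_big/=; apply: eq_bigr => i _.
by apply: eq_bigr => j _; rewrite (metricC _ _ ap) mulrAC.
Qed.

Lemma inner_lower p (u : 'rV[R]_m) X :
  inner g a p u (X a p) = \sum_i u 0 i * lower g X a i p.
Proof.
apply: eq_bigr => i _; rewrite /lower mulr_sumr; apply: eq_bigr => j _.
by rewrite mulrCA mulrA.
Qed.

Definition field_is_pd X r p :=
  forall i, is_pd a r (fun q => X a q 0 i) p (pd a r (fun q => X a q 0 i) p).

Lemma is_pd_lower p r X j : dom a p -> field_is_pd X r p ->
  is_pd a r (lower g X a j) p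
    (\sum_k (pd a r (fun q => g a q j k) p * X a p 0 k
             + g a p j k * pd a r (fun q => X a q 0 k) p)).
Proof.
move=> ap dX; apply: is_pd_sum => k.
by apply: is_pdM => //; exact: metric_is_pd.
Qed.

Lemma nabla_lower_vec p r X j : dom a p -> field_is_pd X r p ->
  nabla_lower g X a r j p = \sum_k g a p j k * nabla_vec g X a r k p.
Proof.
move=> ap dX; rewrite /nabla_lower (pd_val (is_pd_lower j ap dX)).
have connection_lower : \sum_k christoffel g a k r j p * lower g X a k p =
    \sum_k (\sum_q christoffel g a q r j p * g a p q k) * X a p 0 k.
  exact: contractA.
have lower_connection :
    \sum_k g a p j k * (\sum_q christoffel g a k r q p * X a p 0 q) =
    \sum_k (\sum_q christoffel g a q r k p * g a p j q) * X a p 0 k.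
  rewrite contractA; apply: eq_bigr => k _; congr (_ * _).
  by apply: eq_bigr => q _; rewrite mulrC.
under [RHS]eq_bigr => k _ do rewrite mulrDr.
rewrite [in RHS]big_split/= lower_connection connection_lower -sumrB.
rewrite -big_split/=; apply: eq_bigr => k _.
rewrite (metric_compat _ _ _ ap); ring.
Qed.

Lemma is_pd_inner p r X Y : dom a p -> field_is_pd X r p -> field_is_pd Y r p ->
  is_pd a r (fun q => inner g a q (X a q) (Y a q)) p
    (inner g a p (\row_k nabla_vec g X a r k p) (Y a p)
     + inner g a p (X a p) (\row_k nabla_vec g Y a r k p)).
Proof.
move=> ap dX dY; have dlY j := is_pd_lower j ap dY.
have -> : (fun q => inner g a q (X a q) (Y a q)) =
    (fun q => \sum_i X a q 0 i * lower g Y a i q).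
  by apply/funext => q; exact: inner_lower.
apply: is_pd_eq (is_pd_sum (fun i => is_pdM ap (dX i) (dlY i))) _.
rewrite (contract_leibniz (fun i k => christoffel g a i r k p) (fun i => X a p 0 i)
  (fun i => pd a r (fun q => X a q 0 i) p)).
congr (_ + _); first by rewrite inner_lower; apply: eq_bigr => i _; rewrite mxE.
apply: eq_bigr => i _; rewrite -(pd_val (dlY i)) -/(nabla_lower g Y a r i p).
rewrite (nabla_lower_vec _ ap dY) mulr_sumr; apply: eq_bigr => k _.
by rewrite mxE mulrCA mulrA.
Qed.

Section Killing.
Variable X : chart M -> M -> 'rV[R]_m.
Hypotheses (vX : vector_field_on setT X) (kX : killing g X).

Lemma lower_Ck n j : Ck a (dom a) n (lower g X a j).
Proof.
apply: Ck_sum => // k; apply: CkM => //; first exact: metric_Ck.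
by have := vX.1 a k a n; rewrite setTI setIid.
Qed.

Lemma nabla_lower_Ck n i j : Ck a (dom a) n (nabla_lower g X a i j).
Proof.
by apply: nabla_covec_Ck => [*|l]; [exact: christoffel_Ck|exact: lower_Ck].
Qed.

Lemma nabla_lower_skew p i j : dom a p ->
  nabla_lower g X a i j p = - nabla_lower g X a j i p.
Proof. by move=> ap; apply/eqP; rewrite -addr_eq0 kX. Qed.

(* The Killing equation determines all second derivatives of [X]: combine the
   Ricci identities for the three cyclic permutations of the indices. *)
Lemma nabla2_killing p k i j : dom a p ->
  nabla_bilin a (christoffel g a) (nabla_lower g X a) k i j p =
  \sum_l riemann g a i j k l p * lower g X a l p.
Proof.
move=> ap.
pose T r s t := nabla_bilin a (christoffel g a) (nabla_lower g X a) r s t p.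
pose RX r s t := \sum_l riemann g a r s t l p * lower g X a l p.
have ricci r s t : T r s t - T s r t = - RX r s t :=
  ricci_identity christoffel_Ck christoffelC r s t (lower_Ck 2) ap.
have skew r s t : T r s t = - T r t s.
  apply: nabla_bilin_skew ap => [*|q aq *]; first exact: nabla_lower_Ck.
  exact: nabla_lower_skew.
have bianchi : RX i j k + RX j k i + RX k i j = 0.
  rewrite -!big_split/= big1// => l _.
  by rewrite -!mulrDl (first_bianchi_identity christoffelC)// mul0r.
rewrite -/(T k i j) -/(RX i j k); clearbody T RX.
have := ricci k i j; have := ricci i j k; have := ricci j k i.
have := skew i k j; have := skew j i k; have := skew k j i; lra.
Qed.

End Killing.

Section ConstantCurvature.
Variable K : R.
Hypothesis cK : constant_curvature g K.

Lemma curv_up_const p i j k l : dom a p ->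
  curv_up g a i j k l p =
  K * ((i == k)%:R * g a p j l - (i == l)%:R * g a p j k).
Proof.
move=> ap; have delta s : (i == s)%:R = \sum_q invmx (g a p) i q * g a p q s.
  by have /matrixP/(_ i s) := mulVmx (metric_unit ap); rewrite !mxE.
rewrite /curv_up !delta !mulr_suml -sumrB mulr_sumr.
by apply: eq_bigr => q _; rewrite cK//; ring.
Qed.

Lemma pd_curv_const p r i j k l : dom a p ->
  pd a r (curv g a i j k l) p = K *
   (pd a r (fun x => g a x i k) p * g a p j l
    + g a p i k * pd a r (fun x => g a x j l) p
    - (pd a r (fun x => g a x i l) p * g a p j k
       + g a p i l * pd a r (fun x => g a x j k) p)).
Proof.
move=> ap; have dg s t := metric_is_pd r s t ap.
rewrite -(pd_val (is_pdZ K ap (is_pdB (is_pdM ap (dg i k) (dg j l))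
  (is_pdM ap (dg i l) (dg j k))))).
by apply: eq_dom_pd => // q aq; rewrite cK.
Qed.

Lemma nabla_curv_const p r i j k l : dom a p -> nabla_curv g a r i j k l p = 0.
Proof.
move=> ap; apply/eqP; rewrite subr_eq0 pd_curv_const//; apply/eqP.
rewrite !(metric_compat _ _ _ ap) -!big_split/= !mulr_suml !mulr_sumr.
rewrite -!big_split/= -sumrB mulr_sumr; apply: eq_bigr => q _.
by rewrite !cK//; ring.
Qed.

Lemma nabla_curv_sharp_const p s i j k l : dom a p ->
  nabla_curv_sharp g a s i j k l p = 0.
Proof.
move=> ap; rewrite /nabla_curv_sharp big1// => r _.
by rewrite nabla_curv_const// mulr0.
Qed.

End ConstantCurvature.

End LeviCivita.

Section OrthonormalFrame.
Context {R : realType} {m : nat} {M : manifold R m} {h : metric M}.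
Context {gam : clifford_rep R m} (sp : spin_structure h gam).
Variables (t : sp_idx sp) (a : chart M) (p : M).
Hypotheses (tp : sp_dom t p) (ap : dom a p).
Implicit Types (mu nu al be ga : 'I_m) (J : 'I_m -> M -> R[i]).

Lemma frame_is_pd mu be : field_is_pd a (frame t be) mu p.
Proof.
move=> i; have := (frame_field t be).1 a i a 1%N.
by rewrite -setIA setIid => /Ck_is_pd; exact.
Qed.

Lemma spin_form_skew mu be ga :
  spin_form t a mu be ga p = - spin_form t a mu ga be p.
Proof.
apply/eqP; rewrite -addr_eq0 [X in _ + X]innerC//; apply/eqP.
rewrite -(pd_val (is_pd_inner h ap (frame_is_pd mu be) (frame_is_pd mu ga))).
rewrite -(pd_val (is_pd_cst a mu p (be == ga)%:R)); apply: near_pd => //.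
have nta : nbhs p (sp_dom t `&` dom a).
  apply: filterI (nbhs_dom ap); apply: open_nbhs_nbhs.
  by split=> //; exact: sp_open.
apply: filterS nta => q [tq aq].
exact: frame_orthonormal.
Qed.

Lemma frame_expansion (v : 'rV[R]_m) nu :
  \sum_be inner h a p v (frame t be a p) * frame t be a p 0 nu = v 0 nu.
Proof.
pose e : 'M[R]_m := \matrix_(be, i) frame t be a p 0 i.
have orthonormal : e *m (h a p *m e^T) = 1%:M.
  apply/matrixP => be ga; rewrite !mxE -(frame_orthonormal tp ap) /inner.
  apply: eq_bigr => i _; rewrite !mxE mulr_sumr; apply: eq_bigr => j _.
  by rewrite !mxE mulrCA mulrA.
have /(congr1 (fun A => (v *m A) 0 nu)) := mulmx1C orthonormal.
rewrite mulmx1 => <-; rewrite !mulmxA mxE; apply: eq_bigr => be _.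
rewrite [X in _ = _ * X]mxE; congr (_ * _); rewrite mxE /inner exchange_big/=.
apply: eq_bigr => j _; rewrite !mxE mulr_suml; apply: eq_bigr => i _.
by rewrite [h a p i j * _]mulrC.
Qed.

Lemma spin_form_frame mu al nu :
  \sum_be spin_form t a mu al be p * frame t be a p 0 nu =
  nabla_vec h (frame t al) a mu nu p.
Proof. by rewrite frame_expansion mxE. Qed.

Definition form_is_pdC J := forall al mu, is_pdC a mu (J al) p (pdC a mu (J al) p).

Lemma divergenceB J1 J2 : form_is_pdC J1 -> form_is_pdC J2 ->
  divergence t a (fun al q => J1 al q - J2 al q) p =
  divergence t a J1 p - divergence t a J2 p.
Proof.
move=> dJ1 dJ2; rewrite -sumrB; apply: eq_bigr => al _; rewrite -sumrB.
apply: eq_bigr => mu _; rewrite (pdC_val (is_pdCB ap (dJ1 al mu) (dJ2 al mu))).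
under eq_bigr => be _ do rewrite mulrBr.
rewrite sumrB; ring.
Qed.

Lemma divergenceZ c J : form_is_pdC J ->
  divergence t a (fun al q => c * J al q) p = c * divergence t a J p.
Proof.
move=> dJ; rewrite /divergence mulr_sumr; apply: eq_bigr => al _.
rewrite mulr_sumr; apply: eq_bigr => mu _.
rewrite (pdC_val (is_pdCZ c ap (dJ al mu))).
under eq_bigr => be _ do rewrite mulrCA.
rewrite -mulr_sumr; ring.
Qed.

Definition frame_components (w : 'I_m -> M -> R) al q : R[i] :=
  (\sum_nu frame t al a q 0 nu * w nu q)%:C.

Section OneForm.
Variable w : 'I_m -> M -> R.
Hypothesis dw : forall mu nu, is_pd a mu (w nu) p (pd a mu (w nu) p).

Lemma frame_components_is_pdC al mu :
  is_pdC a mu (frame_components w al) p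
    (\sum_nu (pd a mu (fun q => frame t al a q 0 nu) p * w nu p
              + frame t al a p 0 nu * pd a mu (w nu) p))%:C.
Proof.
apply: is_pdC_real; apply: is_pd_sum => nu.
exact: is_pdM (frame_is_pd mu al nu) (dw mu nu).
Qed.

Lemma divergence_frame_components :
  divergence t a (frame_components w) p =
  (\sum_al \sum_mu \sum_nu
     frame t al a p 0 mu * frame t al a p 0 nu
     * nabla_covec a (christoffel h a) w mu nu p)%:C.
Proof.
rewrite rmorph_sum; apply: eq_bigr => al _; rewrite rmorph_sum.
apply: eq_bigr => mu _; rewrite (pdC_val (frame_components_is_pdC al mu)).
rewrite (contract_leibniz (fun nu k => christoffel h a nu mu k p)
  (fun nu => frame t al a p 0 nu)).
have -> : \sum_be (spin_form t a mu al be p)%:C * frame_components w be p =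
    (\sum_nu nabla_vec h (frame t al) a mu nu p * w nu p)%:C.
  under eq_bigr => be _ do rewrite -rmorphM.
  rewrite -rmorph_sum contractA; congr (_%:C); apply: eq_bigr => nu _.
  by rewrite spin_form_frame.
rewrite -rmorphB -rmorphM addrAC subrr add0r mulr_sumr; congr (_%:C).
by apply: eq_bigr => nu _; rewrite mulrA.
Qed.

End OneForm.

End OrthonormalFrame.

Section Pullback.
Context {R : realType} {m n : nat} {M : manifold R m} (h : metric M).
Context {N : manifold R n} (g : metric N) (phi : M -> N).
Hypothesis sphi : smooth_map phi.
Variables (a : chart M) (b : chart N) (p : M).
Hypotheses (ap : dom a p) (bp : dom b (phi p)).
Implicit Types (mu nu la : 'I_m) (i j k l : 'I_n).
Implicit Types (L : 'I_n -> N -> R) (S : 'I_n -> 'I_n -> N -> R).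

Lemma coord_phi_Ck s i :
  Ck a (phi @^-1` dom b `&` dom a) s (fun q => coord b (phi q) 0 i).
Proof. exact: sphi.2 b i a s. Qed.

Lemma dphi_is_pd mu nu i :
  is_pd a mu (dphi phi a b nu i) p (pd a mu (dphi phi a b nu i) p).
Proof. exact: (Ck_is_pd mu (Ck_pd nu (coord_phi_Ck 2 i)) (conj bp ap)). Qed.

Lemma comp_phi_is_pd mu (F : N -> R) : Ck b (dom b) 1 F ->
  is_pd a mu (fun q => F (phi q)) p (\sum_k dphi phi a b mu k p * pd b k F (phi p)).
Proof.
move=> CF; apply: (is_pd_comp ap _ _ _ bp CF) => //; first exact: sphi.1.
  exact: dom_open.
by move=> k; have [] := Ck_is_pd mu (coord_phi_Ck 1 k) (conj bp ap).
Qed.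

Definition pullback_christoffel mu i k : R :=
  \sum_j christoffel g b i j k (phi p) * dphi phi a b mu j p.

Lemma dphi_nabla_covec L mu i :
  \sum_k dphi phi a b mu k p * nabla_covec b (christoffel g b) L k i (phi p) =
  \sum_k dphi phi a b mu k p * pd b k (L i) (phi p)
  - \sum_k pullback_christoffel mu k i * L k (phi p).
Proof.
under eq_bigr => k _ do rewrite mulrBr.
rewrite sumrB contractA; congr (_ - _); apply: eq_bigr => l _; congr (_ * _).
by apply: eq_bigr => k _; rewrite mulrC.
Qed.

Lemma dphi_nabla_bilin S mu i j :
  \sum_k dphi phi a b mu k p * nabla_bilin b (christoffel g b) S k i j (phi p) =
  \sum_k dphi phi a b mu k p * pd b k (S i j) (phi p)
  - \sum_k pullback_christoffel mu k i * S k j (phi p)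
  - \sum_k pullback_christoffel mu k j * S i k (phi p).
Proof.
under eq_bigr => k _ do rewrite !mulrBr.
rewrite !sumrB !contractA; congr (_ - _ - _); apply: eq_bigr => l _; congr (_ * _);
  by apply: eq_bigr => k _; rewrite mulrC.
Qed.

Lemma hessE mu nu i : hess (h := h) g phi a b mu nu i p =
  pd a mu (dphi phi a b nu i) p
  - \sum_la christoffel h a la mu nu p * dphi phi a b la i p
  + \sum_k pullback_christoffel mu i k * dphi phi a b nu k p.
Proof.
rewrite /hess exchange_big/=; congr (_ + _); apply: eq_bigr => k _.
by rewrite mulr_suml.
Qed.

Definition pullback_covec L nu q : R := \sum_i dphi phi a b nu i q * L i (phi q).

Lemma pullback_covec_is_pd L mu nu : (forall i, Ck b (dom b) 1 (L i)) ->
  is_pd a mu (pullback_covec L nu) p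
    (\sum_i (pd a mu (dphi phi a b nu i) p * L i (phi p)
       + dphi phi a b nu i p *
           (\sum_k dphi phi a b mu k p * pd b k (L i) (phi p)))).
Proof.
move=> CL; apply: is_pd_sum => i.
exact: is_pdM (dphi_is_pd mu nu i) (comp_phi_is_pd mu (CL i)).
Qed.

Lemma nabla_pullback_covec L mu nu : (forall i, Ck b (dom b) 1 (L i)) ->
  nabla_covec a (christoffel h a) (pullback_covec L) mu nu p =
  \sum_i hess (h := h) g phi a b mu nu i p * L i (phi p)
  + \sum_i dphi phi a b nu i p *
      (\sum_k dphi phi a b mu k p * nabla_covec b (christoffel g b) L k i (phi p)).
Proof.
move=> CL; rewrite /nabla_covec (pd_val (pullback_covec_is_pd mu nu CL)) contractA.
rewrite (contract_leibniz (pullback_christoffel mu) (fun i => dphi phi a b nu i p)).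
rewrite addrAC -sumrB; congr (_ + _); apply: eq_bigr => i _.
  by rewrite -mulrBl hessE; congr (_ * _); ring.
by rewrite -dphi_nabla_covec.
Qed.

End Pullback.

Section DivergenceOfPullback.
Context {R : realType} {m n : nat} {M : manifold R m} {h : metric M}.
Context {gam : clifford_rep R m} (sp : spin_structure h gam).
Context {N : manifold R n} (g : metric N) (phi : M -> N).
Hypothesis sphi : smooth_map phi.
Variables (t : sp_idx sp) (a : chart M) (b : chart N) (p : M).
Hypotheses (tp : sp_dom t p) (ap : dom a p) (bp : dom b (phi p)).
Implicit Types (mu nu al : 'I_m) (i j k l : 'I_n).
Variable L : 'I_n -> N -> R.
Hypothesis CL : forall i, Ck b (dom b) 1 (L i).

Definition dphi_pairing al q : R[i] :=
  (\sum_i dphi_frame phi t a b al i q * L i (phi q))%:C.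

Lemma dphi_pairingE :
  dphi_pairing = frame_components t a (pullback_covec phi a b L).
Proof.
apply/funext => al; apply/funext => q.
by rewrite /frame_components contractA.
Qed.

Let pullback_is_pd mu nu := is_pd_pd (pullback_covec_is_pd sphi ap bp mu nu CL).

Lemma dphi_pairing_is_pdC : form_is_pdC a p dphi_pairing.
Proof.
move=> al mu; rewrite dphi_pairingE.
exact: is_pdC_pdC (frame_components_is_pdC tp ap pullback_is_pd al mu).
Qed.

Lemma sum_frame_hess :
  \sum_al \sum_mu \sum_nu frame t al a p 0 mu * frame t al a p 0 nu *
    (\sum_i hess (h := h) g phi a b mu nu i p * L i (phi p)) =
  \sum_i tension g phi t a b i p * L i (phi p).
Proof. exact: contractA3. Qed.

Lemma sum_frame_dphi al :
  \sum_mu \sum_nu frame t al a p 0 mu * frame t al a p 0 nu *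
    (\sum_i dphi phi a b nu i p *
      (\sum_k dphi phi a b mu k p
         * nabla_covec b (christoffel g b) L k i (phi p))) =
  \sum_i \sum_k dphi_frame phi t a b al i p * dphi_frame phi t a b al k p
    * nabla_covec b (christoffel g b) L k i (phi p).
Proof.
under eq_bigr => mu _ do under eq_bigr => nu _ do under eq_bigr => i _ do
  rewrite mulr_sumr.
under eq_bigr => mu _ do under eq_bigr => nu _ do under eq_bigr => i _ do
  under eq_bigr => k _ do rewrite mulrA.
rewrite contractA2; apply: eq_bigr => i _; apply: eq_bigr => k _; congr (_ * _).
rewrite [RHS]mulrC /dphi_frame big_distrlr/=; apply: eq_bigr => mu _.
by apply: eq_bigr => nu _; ring.
Qed.

Lemma divergence_dphi_pairing :
  divergence t a dphi_pairing p =
  (\sum_i tension g phi t a b i p * L i (phi p)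
   + \sum_al \sum_i \sum_k dphi_frame phi t a b al i p
       * dphi_frame phi t a b al k p
       * nabla_covec b (christoffel g b) L k i (phi p))%:C.
Proof.
rewrite dphi_pairingE (divergence_frame_components tp ap pullback_is_pd).
congr (_%:C); rewrite -sum_frame_hess -big_split; apply: eq_bigr => al _.
rewrite -sum_frame_dphi -big_split; apply: eq_bigr => mu _; rewrite -big_split.
by apply: eq_bigr => nu _; rewrite (nabla_pullback_covec h g sphi ap bp)// mulrDr.
Qed.

End DivergenceOfPullback.

Section DivergenceOfSpinorCurrent.
Context {R : realType} {m n : nat} {M : manifold R m} {h : metric M}.
Context {gam : clifford_rep R m} (sp : spin_structure h gam).
Context {N : manifold R n} (g : metric N) (phi : M -> N).
Variable psi : sp_idx sp -> chart N -> M -> 'I_n -> 'cV[R[i]]_(spdim m).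
Hypotheses (sphi : smooth_map phi) (spsi : vector_spinor phi psi).
Variables (t : sp_idx sp) (a : chart M) (b : chart N) (p : M).
Hypotheses (tp : sp_dom t p) (ap : dom a p) (bp : dom b (phi p)).
Implicit Types (mu al be : 'I_m) (i j k l : 'I_n) (q : M).

Definition clifford_pairing al i j q : R[i] :=
  herm (psi t b q i) (gam al *m psi t b q j).

Definition pd_psi mu i : 'cV[R[i]]_(spdim m) :=
  \col_s pdC a mu (fun q => psi t b q i s 0) p.

Lemma psi_is_pdC mu i s :
  is_pdC a mu (fun q => psi t b q i s 0) p (pd_psi mu i s 0).
Proof. by rewrite mxE; exact: (smoothC_is_pdC mu (spsi.1 t b i s)). Qed.

Lemma clifford_pairing_is_pdC mu al i j :
  is_pdC a mu (clifford_pairing al i j) p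
    (herm (pd_psi mu i) (gam al *m psi t b p j)
     + herm (psi t b p i) (gam al *m pd_psi mu j)).
Proof.
apply: (is_pdC_herm ap) => s; first exact: psi_is_pdC.
by apply: (is_pdC_mulmx _ _ ap) => r; exact: psi_is_pdC.
Qed.

Lemma nabla_psiE mu i : nabla_psi g phi psi t a b mu i p =
  pd_psi mu i
  + spin_matrix gam (fun be ga => spin_form t a mu be ga p) *m psi t b p i
  + \sum_k (pullback_christoffel g phi a b p mu i k)%:C *: psi t b p k.
Proof.
rewrite /nabla_psi [X in _ + X]exchange_big/=; congr (_ + _ + _).
  rewrite /spin_matrix -scalemxAl mulmx_suml; congr (_ *: _).
  apply: eq_bigr => be _; rewrite mulmx_suml; apply: eq_bigr => ga _.
  by rewrite -scalemxAl.
by apply: eq_bigr => k _; rewrite rmorph_sum scaler_suml.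
Qed.

Lemma nabla_clifford_pairing mu al i j :
  herm (nabla_psi g phi psi t a b mu i p) (gam al *m psi t b p j)
  + herm (psi t b p i) (gam al *m nabla_psi g phi psi t a b mu j p) =
  pdC a mu (clifford_pairing al i j) p
  - \sum_be (spin_form t a mu al be p)%:C * clifford_pairing be i j p
  + \sum_k (pullback_christoffel g phi a b p mu i k)%:C * clifford_pairing al k j p
  + \sum_k (pullback_christoffel g phi a b p mu j k)%:C * clifford_pairing al i k p.
Proof.
rewrite (pdC_val (clifford_pairing_is_pdC mu al i j)) !nabla_psiE.
rewrite !mulmxDr !linearDl !linearDr/=.
rewrite -(spin_matrix_herm gam (fun be ga => spin_form_skew tp ap mu be ga)).
have -> : herm (\sum_k (pullback_christoffel g phi a b p mu i k)%:C *: psi t b p k)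
    (gam al *m psi t b p j) =
    \sum_k (pullback_christoffel g phi a b p mu i k)%:C * clifford_pairing al k j p.
  rewrite linear_sumlz/=; apply: eq_bigr => k _.
  by rewrite hermZl conjc_real.
have -> : herm (psi t b p i) (gam al *m
    \sum_k (pullback_christoffel g phi a b p mu j k)%:C *: psi t b p k) =
    \sum_k (pullback_christoffel g phi a b p mu j k)%:C * clifford_pairing al i k p.
  rewrite mulmx_sumr linear_sumr/=; apply: eq_bigr => k _.
  by rewrite -scalemxAr hermZr.
ring.
Qed.

Lemma sum_frame_nabla_clifford_pairing i j :
  \sum_al \sum_mu (frame t al a p 0 mu)%:C *
    (herm (nabla_psi g phi psi t a b mu i p) (gam al *m psi t b p j)
     + herm (psi t b p i) (gam al *m nabla_psi g phi psi t a b mu j p)) =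
  herm (psi t b p i) (dirac g phi psi t a b j p)
  - herm (dirac g phi psi t a b i p) (psi t b p j).
Proof.
rewrite /dirac linear_sumr linear_sumlz/= -sumrB; apply: eq_bigr => al _.
rewrite herm_gam opprK linear_sumlz mulmx_sumr linear_sumr/= addrC -big_split/=.
apply: eq_bigr => mu _.
by rewrite hermZl conjc_real -scalemxAr hermZr mulrDr.
Qed.

Variable S : 'I_n -> 'I_n -> N -> R.
Hypothesis CS : forall i j, Ck b (dom b) 1 (S i j).

Definition spinor_current al q : R[i] :=
  \sum_i \sum_j clifford_pairing al i j q * (S i j (phi q))%:C.

Lemma spinor_current_is_pdC mu al :
  is_pdC a mu (spinor_current al) p
   (\sum_i \sum_j (pdC a mu (clifford_pairing al i j) p * (S i j (phi p))%:C
     + clifford_pairing al i j p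
       * (\sum_k dphi phi a b mu k p * pd b k (S i j) (phi p))%:C)).
Proof.
apply: is_pdC_sum => i; apply: is_pdC_sum => j; apply: (is_pdCM ap).
  exact: is_pdC_pdC (clifford_pairing_is_pdC mu al i j).
by apply: is_pdC_real; exact: comp_phi_is_pd.
Qed.

Lemma nabla_spinor_current mu al :
  pdC a mu (spinor_current al) p
  - \sum_be (spin_form t a mu al be p)%:C * spinor_current be p =
  \sum_i \sum_j
    (herm (nabla_psi g phi psi t a b mu i p) (gam al *m psi t b p j)
     + herm (psi t b p i) (gam al *m nabla_psi g phi psi t a b mu j p))
    * (S i j (phi p))%:C
  + \sum_i \sum_j clifford_pairing al i j p *
      (\sum_k dphi phi a b mu k p
         * nabla_bilin b (christoffel g b) S k i j (phi p))%:C.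
Proof.
rewrite (pdC_val (spinor_current_is_pdC mu al)) (contract_leibniz2
  (fun i k => (pullback_christoffel g phi a b p mu i k)%:C)
  (fun i j => clifford_pairing al i j p)).
have -> : \sum_be (spin_form t a mu al be p)%:C * spinor_current be p =
    \sum_i \sum_j (\sum_be (spin_form t a mu al be p)%:C
      * clifford_pairing be i j p) * (S i j (phi p))%:C.
  under eq_bigr => be _ do rewrite mulr_sumr.
  rewrite exchange_big/=; apply: eq_bigr => i _.
  under eq_bigr => be _ do rewrite mulr_sumr.
  rewrite exchange_big/=; apply: eq_bigr => j _.
  by rewrite mulr_suml; apply: eq_bigr => be _; rewrite mulrA.
rewrite addrAC -sumrB; congr (_ + _); apply: eq_bigr => i _.
  rewrite -sumrB; apply: eq_bigr => j _.
  by rewrite -mulrBl nabla_clifford_pairing; congr (_ * _); ring.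
apply: eq_bigr => j _; congr (_ * _); rewrite dphi_nabla_bilin !rmorphB !rmorph_sum.
by congr (_ - _ - _); apply: eq_bigr => k _; rewrite rmorphM.
Qed.

Lemma sum_frame_dphi_nabla_bilin al i j :
  \sum_mu (frame t al a p 0 mu)%:C *
    (\sum_k dphi phi a b mu k p
       * nabla_bilin b (christoffel g b) S k i j (phi p))%:C =
  (\sum_k dphi_frame phi t a b al k p
     * nabla_bilin b (christoffel g b) S k i j (phi p))%:C.
Proof.
under eq_bigr => mu _ do rewrite -rmorphM.
by rewrite -rmorph_sum contractA.
Qed.

Lemma divergence_spinor_current :
  divergence t a spinor_current p =
  \sum_i \sum_j (herm (psi t b p i) (dirac g phi psi t a b j p)
       - herm (dirac g phi psi t a b i p) (psi t b p j)) * (S i j (phi p))%:C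
  + \sum_al \sum_i \sum_j clifford_pairing al i j p *
      (\sum_k dphi_frame phi t a b al k p
         * nabla_bilin b (christoffel g b) S k i j (phi p))%:C.
Proof.
rewrite /divergence; under eq_bigr => al _ do under eq_bigr => mu _ do
  rewrite nabla_spinor_current mulrDr.
under eq_bigr => al _ do rewrite big_split/=.
rewrite big_split/= contractA2; congr (_ + _).
  apply: eq_bigr => i _; apply: eq_bigr => j _.
  by rewrite sum_frame_nabla_clifford_pairing.
apply: eq_bigr => al _; under eq_bigr => mu _ do rewrite mulr_sumr.
rewrite exchange_big/=; apply: eq_bigr => i _.
under eq_bigr => mu _ do rewrite mulr_sumr.
rewrite exchange_big/=; apply: eq_bigr => j _.
rewrite -sum_frame_dphi_nabla_bilin mulr_sumr.
by apply: eq_bigr => mu _; rewrite mulrCA.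
Qed.

End DivergenceOfSpinorCurrent.

Lemma sum_skew_eq0 (R : realFieldType) n (F : 'I_n -> 'I_n -> R) (v : 'I_n -> R) :
  (forall i j, F i j = - F j i) -> \sum_i \sum_j v i * v j * F i j = 0.
Proof.
move=> FN; set s := LHS; suff : s = - s by move=> sN; lra.
rewrite {1}/s exchange_big/= /s -sumrN; apply: eq_bigr => i _.
by rewrite -sumrN; apply: eq_bigr => j _; rewrite FN; ring.
Qed.

Section KillingCurrent.
Context {R : realType} {m n : nat} {M : manifold R m} {h : metric M}.
Context {gam : clifford_rep R m} (sp : spin_structure h gam).
Context {N : manifold R n} (g : metric N) (phi : M -> N).
Variable psi : sp_idx sp -> chart N -> M -> 'I_n -> 'cV[R[i]]_(spdim m).
Variable X : chart N -> N -> 'rV[R]_n.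
Hypotheses (vX : vector_field_on setT X) (kX : killing g X).
Variables (t : sp_idx sp) (a : chart M) (b : chart N) (p : M).
Hypotheses (tp : sp_dom t p) (ap : dom a p) (bp : dom b (phi p)).
Implicit Types (al : 'I_m) (i j k l : 'I_n).

Lemma currentE : current g phi psi X t a b =
  fun al q => 2 * dphi_pairing phi t a b (lower g X b) al q
              - spinor_current phi psi t b (nabla_lower g X b) al q.
Proof.
apply/funext => al; apply/funext => q; congr (_ - _).
rewrite inner_lower /dphi_pairing rmorphM rmorph_nat; congr (_ * _%:C).
by apply: eq_bigr => i _; rewrite mxE.
Qed.

Lemma divergence_current : smooth_map phi -> vector_spinor phi psi ->
  divergence t a (current g phi psi X t a b) p =
  2 * (\sum_i tension g phi t a b i p * lower g X b i (phi p))%:C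
  - (\sum_i \sum_j (herm (psi t b p i) (dirac g phi psi t a b j p)
       - herm (dirac g phi psi t a b i p) (psi t b p j))
       * (nabla_lower g X b i j (phi p))%:C
     + \sum_al \sum_i \sum_j clifford_pairing psi t b al i j p
       * (\sum_k dphi_frame phi t a b al k p *
            nabla_bilin b (christoffel g b) (nabla_lower g X b) k i j (phi p))%:C).
Proof.
move=> sphi spsi; have CL := lower_Ck g b vX 1; have CS := nabla_lower_Ck g b vX 1.
have dL := dphi_pairing_is_pdC sphi tp ap bp CL.
have dS : form_is_pdC a p (spinor_current phi psi t b (nabla_lower g X b)).
  move=> al mu.
  exact: is_pdC_pdC (spinor_current_is_pdC sphi spsi tp ap bp CS mu al).
rewrite currentE divergenceB//; last first.
  by move=> al mu; exact: is_pdC_pdC (is_pdCZ 2 ap (dL al mu)).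
rewrite divergenceZ// (divergence_dphi_pairing g sphi tp ap bp CL).
rewrite (divergence_spinor_current g sphi spsi tp ap bp CS).
rewrite [X in (_ + X)%:C]big1 ?addr0// => al _.
apply: sum_skew_eq0 => i k; exact: nabla_lower_skew.
Qed.

End KillingCurrent.

Section ConstantCurvatureTarget.
Context {R : realType} {m n : nat} {M : manifold R m} {h : metric M}.
Context {gam : clifford_rep R m} (sp : spin_structure h gam).
Context {N : manifold R n} (g : metric N) (phi : M -> N).
Variable psi : sp_idx sp -> chart N -> M -> 'I_n -> 'cV[R[i]]_(spdim m).
Variables (K kappa : R).
Hypotheses (cK : constant_curvature g K).
Hypothesis dh : kappa_dirac_harmonic g phi psi kappa.
Variables (t : sp_idx sp) (a : chart M) (b : chart N) (p : M).
Hypotheses (tp : sp_dom t p) (ap : dom a p) (bp : dom b (phi p)).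
Implicit Types (i j k l q : 'I_n).

Let G i j : R[i] := (g b (phi p) i j)%:C.
Let H i j : R[i] := herm (psi t b p i) (psi t b p j).

Lemma dirac_const_curvature i : dirac g phi psi t a b i p =
  (- 2 * kappa * K)%:C *: ((\sum_j \sum_l G j l * H j l) *: psi t b p i
                           - \sum_j \sum_k (G j k * H j i) *: psi t b p k).
Proof.
rewrite (dh tp ap bp i).2 [(- 2 * kappa * K)%:C]rmorphM -scalerA; congr (_ *: _).
rewrite scaler_suml -sumrB scaler_sumr; apply: eq_bigr => j _.
have curvE k l : ((curv_up g b i j k l (phi p))%:C * H j l) *: psi t b p k =
    K%:C *: ((i == k)%:R *: ((G j l * H j l) *: psi t b p k)
             - (i == l)%:R *: ((G j k * H j l) *: psi t b p k)).
  rewrite (curv_up_const cK)// rmorphM rmorphB !rmorphM !rmorph_nat.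
  by rewrite !scalerA -scalerBl scalerA; congr (_ *: _); rewrite /G; ring.
under eq_bigr => k _ do under eq_bigr => l _ do rewrite curvE.
under eq_bigr => k _ do rewrite -scaler_sumr sumrB sum_deltaZ.
rewrite -scaler_sumr sumrB exchange_big/= scaler_suml; congr (_ *: (_ - _)).
by apply: eq_bigr => l _; rewrite sum_deltaZ.
Qed.

Lemma herm_dirac_sym i j :
  herm (psi t b p i) (dirac g phi psi t a b j p) =
  herm (dirac g phi psi t a b i p) (psi t b p j).
Proof.
have GC r s : G r s = G s r by rewrite /G (metricC g _ _ bp).
have conjGH r s k l : conjc (G r s * H k l) = G r s * H l k.
  by rewrite rmorphM; congr (_ * _); [exact: conjc_real|exact: herm_conj].
rewrite !dirac_const_curvature hermZl hermZr conjc_real; congr (_ * _).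
rewrite linearBl linearBr/= hermZl hermZr; congr (_ * _ - _).
  rewrite rmorph_sum exchange_big/=; apply: eq_bigr => l _.
  rewrite rmorph_sum/=; apply: eq_bigr => k _.
  by rewrite conjGH GC.
rewrite linear_sumr linear_sumlz/=.
under eq_bigr => k _ do rewrite linear_sumr/=.
rewrite exchange_big/=; apply: eq_bigr => k _.
rewrite linear_sumlz/=; apply: eq_bigr => l _.
by rewrite hermZl hermZr conjGH GC mulrAC.
Qed.

Lemma tension_const_curvature r : (tension g phi t a b r p)%:C =
  2^-1 * \sum_al \sum_i \sum_j clifford_pairing psi t b al i j p *
    (\sum_k dphi_frame phi t a b al k p * riemann g b i j k r (phi p))%:C.
Proof.
rewrite (dh tp ap bp r).1 [X in _ + _ * X]big1 ?mulr0 ?addr0 => [|i _]; last first.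
  rewrite big1// => j _; rewrite big1// => k _; rewrite big1// => l _.
  by rewrite (nabla_curv_sharp_const cK)// !mul0r.
congr (_ * _); apply: eq_bigr => al _; apply: eq_bigr => i _; apply: eq_bigr => j _.
rewrite -mulr_sumr -rmorph_sum; congr (_ * _%:C).
by apply: eq_bigr => k _; rewrite mulrC.
Qed.

Lemma tension_killing X : vector_field_on setT X -> killing g X ->
  2 * (\sum_r tension g phi t a b r p * lower g X b r (phi p))%:C =
  \sum_al \sum_i \sum_j clifford_pairing psi t b al i j p
    * (\sum_k dphi_frame phi t a b al k p
         * nabla_bilin b (christoffel g b) (nabla_lower g X b) k i j (phi p))%:C.
Proof.
move=> vX kX; rewrite rmorph_sum mulr_sumr.
under eq_bigr => r _ do
  rewrite rmorphM [X in _ * (X * _)]tension_const_curvature !mulrA mulfV// mul1r.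
rewrite -contractA3; apply: eq_bigr => al _; apply: eq_bigr => i _.
apply: eq_bigr => j _; congr (_ * _).
under [in RHS]eq_bigr => k _ do rewrite (nabla2_killing vX kX)//.
rewrite contractA rmorph_sum; apply: eq_bigr => r _.
by rewrite rmorphM.
Qed.

End ConstantCurvatureTarget.

Theorem theorem4p7 (R : realType) (m n : nat)
  (M : manifold R m) (h : metric M)
  (gam : clifford_rep R m) (sp : spin_structure h gam)
  (N : manifold R n) (g : metric N) (K : R)
  (X : chart N -> N -> 'rV[R]_n) (kappa : R)
  (phi : M -> N)
  (psi : sp_idx sp -> chart N -> M -> 'I_n -> 'cV[R[i]]_(spdim m)) :
  closed_manifold M ->
  constant_curvature g K ->
  vector_field_on setT X -> killing g X ->
  smooth_map phi -> vector_spinor phi psi ->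
  kappa_dirac_harmonic g phi psi kappa ->
  conserved phi (current g phi psi X).
Proof.
move=> _ cK vX kX sphi spsi dh t a b p tp ap bp.
rewrite (divergence_current vX kX tp ap bp sphi spsi).
rewrite (tension_killing cK dh tp ap bp vX kX).
rewrite [X in _ - (X + _)]big1 ?add0r ?subrr// => i _.
by rewrite big1// => j _; rewrite (herm_dirac_sym cK dh tp ap bp) subrr mul0r.
Qed.
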